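(* Let $T\ge 1$, let $\Sigma_u,\Sigma_x$ be symmetric positive definite $T\times T$ matrices, and let $\mathcal{U}$ be a Gaussian process on $\mathbb{R}^T\times\mathbb{R}^T$ with stationary squared exponential covariance $$k_u([x,y],[v,w])=\sigma_u^2\exp\left(-\tfrac12 (x-v)^\intercal\Sigma_u^{-1}(x-v)-\tfrac12 (y-w)^\intercal\Sigma_u^{-1}(y-w)\right),\qquad \sigma_u>0.$$ Let $\mathcal{F}(x,y)=\mathcal{U}(x,y)-\mathcal{U}(y,x)$ with $\mathbb{E}[\mathcal{F}(x,y)]=0$ for all $x,y$. Let the attributes be i.i.d. multivariate Gaussian with covariance $\Sigma_x$, drawn independently of $\mathcal{F}$. Then, for any matrix $R$ similar to $\Sigma_u^{-1}\Sigma_x$, the shared-endpoint correlation is $$\rho(R)=\frac{\det(I+2R)^{-1/2}-\det(I+R)^{-1/2}\det(I+3R)^{-1/2}}{1-\det(I+4R)^{-1/2}}.$$ Moreover, if $r_j=\sqrt{\lambda_j(R)}$, $j=1,\dots,T$, where $\lambda_1(R),\dots,\lambda_T(R)$ are the eigenvalues of $R$, then $$\rho(r)=\frac{\prod_{j=1}^T(1+2r_j^2)^{-1/2}-\prod_{j=1}^T(1+r_j^2)^{-1/2}(1+3r_j^2)^{-1/2}}{1-\prod_{j=1}^T(1+4r_j^2)^{-1/2}}.$$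
   Context: Let $X,Y,W$ be i.i.d. draws from the attribute distribution $\pi_X$, independent of the random skew-symmetric function $\mathcal{F}$. The variance and the shared-endpoint correlation are $$\sigma^2=\mathbb{E}_{\mathcal{F}}\left[\mathrm{Var}_{X,Y}(\mathcal{F}(X,Y)\mid\mathcal{F})\right],\qquad \rho=\frac{1}{\sigma^2}\,\mathbb{E}_{\mathcal{F}}\left[\mathrm{Cov}_{X,Y,W}(\mathcal{F}(X,Y),\mathcal{F}(X,W)\mid\mathcal{F})\right].$$ The numbers $r_j$ are called the roughness coefficients (or roughness values). *)

(* Defs.v *)
From HB Require Import structures.
From mathcomp Require Export all_boot all_order all_algebra.
From mathcomp Require Export mxred.
From mathcomp Require Export all_classical all_reals all_analysis.

Set Implicit Arguments.
Unset Strict Implicit.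
Unset Printing Implicit Defensive.
Import Order.TTheory GRing.Theory Num.Theory.
Import numFieldNormedType.Exports.
Local Open Scope classical_set_scope.
Local Open Scope ring_scope.

(* Points of R^T are T-tuples, because these carry the library's product
   (Borel) sigma-algebra; [colvec] turns them into vectors for matrix algebra. *)
Definition colvec (R : realType) (T : nat) (x : T.-tuple R) : 'cV[R]_T :=
  \col_i tnth x i.

Definition spd_mx (R : realType) (T : nat) (A : 'M[R]_T) : Prop :=
  A^T = A /\ forall v : 'cV[R]_T, v != 0 -> 0 < (v^T *m A *m v) 0 0.

Definition inv_quad (R : realType) (T : nat) (S : 'M[R]_T) (v : 'cV[R]_T) : R :=
  (v^T *m invmx S *m v) 0 0.

Definition se_kernel (R : realType) (T : nat) (sigma_u : R) (Sigma_u : 'M[R]_T)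
    (p q : T.-tuple R * T.-tuple R) : R :=
  sigma_u ^+ 2 *
  expR (- (2^-1 * inv_quad Sigma_u (colvec p.1 - colvec q.1))
        - 2^-1 * inv_quad Sigma_u (colvec p.2 - colvec q.2)).

(* A univariate normal variable, constants included.  The case s = 0 is separate
   because [normal_prob m 0] is by convention not the point mass at m. *)
Definition gaussian_rv (R : realType) (d : measure_display)
    (Omega : measurableType d) (P : probability Omega R) (Z : Omega -> R) : Prop :=
  exists m s : R, 0 <= s /\ forall B : set R, measurable B ->
    P (Z @^-1` B) = if s == 0 then (\d_m B)%E else normal_prob m s B.

(* All finite-dimensional marginals are multivariate normal, i.e. every finite
   linear combination is univariate normal. *)
Definition gaussian_process (R : realType) (d : measure_display)
    (Omega : measurableType d) (P : probability Omega R) (I : Type)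
    (U : I -> Omega -> R) : Prop :=
  forall (n : nat) (t : 'I_n -> I) (c : 'I_n -> R),
    gaussian_rv P (fun w => \sum_(j < n) c j * U (t j) w).

(* mu is a multivariate normal law on R^T with covariance matrix S and arbitrary
   mean. *)
Definition multivariate_gaussian (R : realType) (T : nat)
    (mu : probability (T.-tuple R) R) (S : 'M[R]_T) : Prop :=
  (forall c : 'I_T -> R, gaussian_rv mu (fun x => \sum_(i < T) c i * tnth x i)) /\
  (forall i j : 'I_T,
     covariance mu (fun x => tnth x i) (fun x => tnth x j) = (S i j)%:E).

Definition has_law (R : realType) (d d' : measure_display)
    (Omega : measurableType d) (E : measurableType d') (P : probability Omega R)
    (X : {RV P >-> E}) (mu : probability E R) : Prop :=
  forall B : set E, measurable B -> distribution P X B = mu B.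

Definition mutually_independent (R : realType) (d : measure_display)
    (Omega : measurableType d) (P : probability Omega R) (I : finType)
    (G : I -> set (set Omega)) : Prop :=
  forall (J : {set I}) (A : I -> set Omega), (forall i, i \in J -> G i (A i)) ->
    P (\bigcap_(i in [set` J]) A i) = (\prod_(i in J) P (A i))%E.

Definition sigma_rv (R : realType) (d d' : measure_display)
    (Omega : measurableType d) (E : measurableType d') (P : probability Omega R)
    (X : {RV P >-> E}) : set (set Omega) :=
  preimage_set_system setT X measurable.

(* A random function on E x E; its events are the cylinders {F(x,y) \in B}, which
   generate the sigma-algebra <<s random_function_events F >> of F. *)
Definition random_function_events (R : realType) (Omega E : Type)
    (F : E -> E -> Omega -> R) : set (set Omega) :=
  [set A | exists x y : E, exists2 B : set R, measurable B & A = F x y @^-1` B].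

(* The evaluation (F, (x, y)) |-> F(x, y) is measurable in the realisation of F
   and the arguments together: this is what makes F(X, Y) a random variable which
   depends on the sample point only through F, X and Y.  It holds in particular
   when F has continuous sample paths. *)
Definition measurable_random_function (R : realType) (d d' : measure_display)
    (Omega : measurableType d) (E : measurableType d')
    (F : E -> E -> Omega -> R) : Prop :=
  measurable_fun
    [set: (g_sigma_algebraType (random_function_events F) * (E * E))%type]
    (fun q => F q.2.1 q.2.2 q.1).

(* V is a version of E[Z | <<s G >>] *)
Definition is_condexp (R : realType) (d : measure_display)
    (Omega : measurableType d) (P : probability Omega R) (G : set (set Omega))
    (Z V : Omega -> R) : Prop :=
  [/\ measurable_fun [set: g_sigma_algebraType G] V,
      P.-integrable setT (EFin \o V) &
      forall A : set Omega, <<s G >> A ->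
        (\int[P]_(w in A) (V w)%:E = \int[P]_(w in A) (Z w)%:E)%E].

Definition condexp (R : realType) (d : measure_display)
    (Omega : measurableType d) (P : probability Omega R) (G : set (set Omega))
    (Z : Omega -> R) : Omega -> R :=
  xget (cst 0) [set V | is_condexp P G Z V].

Definition condcov (R : realType) (d : measure_display)
    (Omega : measurableType d) (P : probability Omega R) (G : set (set Omega))
    (Z1 Z2 : Omega -> R) : Omega -> R :=
  condexp P G (fun w => (Z1 w - condexp P G Z1 w) * (Z2 w - condexp P G Z2 w)).

Definition condvar (R : realType) (d : measure_display)
    (Omega : measurableType d) (P : probability Omega R) (G : set (set Omega))
    (Z : Omega -> R) : Omega -> R := condcov P G Z Z.

Definition variance_F (R : realType) (d : measure_display)
    (Omega : measurableType d) (P : probability Omega R) (E : Type)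
    (F : E -> E -> Omega -> R) (X Y : Omega -> E) : R :=
  fine 'E_P[condvar P (random_function_events F) (fun w => F (X w) (Y w) w)]%E.

Definition shared_endpoint_correlation (R : realType) (d : measure_display)
    (Omega : measurableType d) (P : probability Omega R) (E : Type)
    (F : E -> E -> Omega -> R) (X Y W : Omega -> E) : R :=
  (variance_F P F X Y)^-1 *
  fine 'E_P[condcov P (random_function_events F)
              (fun w => F (X w) (Y w) w) (fun w => F (X w) (W w) w)]%E.

(* Main.v *)
(** Swapping X and Y preserves their joint law with F but turns F(X,Y) into
    -F(X,Y), so E[F(X,Y) | F] = 0.  Hence sigma^2 = E[F(X,Y)^2] and the numerator of
    rho is E[F(X,Y) F(X,W)].  Averaging over F first leaves, up to the common factor
    2 sigma_u^2, the means of exp(-q(x-y)), exp(-q(y-w)/2) and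
    exp(-(q(x-w) + q(x-y))/2), where q(v) = v^T Sigma_u^-1 v = |K v|^2 for a factor K
    of Sigma_u^-1.  By the parallelogram law each of these is exp(-|L|^2/2) for a
    centred Gaussian vector L whose covariance C is block diagonal, with blocks
    conjugate to multiples of Sigma_u^-1 Sigma_x, and E[exp(-|L|^2/2)] =
    det(1 + C)^(-1/2).

    The multivariate normal law is known only through its one-dimensional
    projections, that is, through E[cos(a.L)] = exp(-a C a^T / 2).  The last formula
    follows from this alone: exp(-L_0^2/2) is the mean of cos(t L_0) over a standard
    normal t, so integrating t out of E[cos(t L_0 + a.L')] removes one coordinate at a
    time and replaces C by a Schur complement. *)

(* The numbers 1, 2, 3, 4 in the determinants are squared norms. A vector [a] in R^3 with zero
   coordinate sum gives the form a_0 X + a_1 Y + a_2 W, in which the unknown mean of the attributes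
   cancels and whose covariance is |a|^2 [Sigma_x]; orthogonal vectors give uncorrelated forms.

   Two points of measure theory shape the rest. First, [condexp] is a chosen version, or a default
   constant if there is none. Existence comes from Radon-Nikodym on the sub-sigma-algebra, and any
   version of a vanishing conditional mean is shown to be 0 almost everywhere, so the choice does
   not affect rho. Second, the sample space carries two sigma-algebras, its own and the one
   generated by F, and joint measurability of the evaluation is given for the latter. Expectations
   of functions of (F, X, Y, W) are therefore computed on the product of P restricted to that
   sigma-algebra with three copies of the attribute law; independence enters only through this
   product. *)
From HB Require Import structures.
Require Import Defs.
From mathcomp Require Import measurable_realfun ring lra.

Set Implicit Arguments.
Unset Strict Implicit.
Unset Printing Implicit Defensive.
Import Order.TTheory GRing.Theory Num.Theory.
Import numFieldNormedType.Exports.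
Local Open Scope classical_set_scope.
Local Open Scope ring_scope.

(** * Integrals as values *)

Section has_mean.
Context d (T : measurableType d) (R : realType) (mu : {measure set T -> \bar R}).
Implicit Types f g : T -> R.

(** Integrability and a finite value travel together, so that linearity, transport and Fubini each
    consume and produce both. *)
Definition has_mean f (r : R) : Prop :=
  mu.-integrable setT (EFin \o f) /\ (\int[mu]_x (f x)%:E = r%:E)%E.

Lemma eq_has_mean f g r : f =1 g -> has_mean f r -> has_mean g r.
Proof. by move=> /funext ->. Qed.

Lemma has_mean_uniq f r s : has_mean f r -> has_mean f s -> r = s.
Proof. by move=> [_ E] [_]; rewrite E => -[]. Qed.

Lemma has_meanD f g r s :
  has_mean f r -> has_mean g s -> has_mean (f \+ g) (r + s).
Proof.
move=> [If Ef] [Ig Eg]; split; first exact: (integrableD measurableT If Ig).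
by under eq_integral do rewrite EFinD; rewrite integralD// Ef Eg.
Qed.

Lemma has_meanZ f k r : has_mean f r -> has_mean (fun x => k * f x) (k * r).
Proof.
move=> [If Ef]; split; first exact: (integrableZl measurableT k If).
by under eq_integral do rewrite EFinM; rewrite integralZl// Ef.
Qed.

Lemma has_meanB f g r s :
  has_mean f r -> has_mean g s -> has_mean (f \- g) (r - s).
Proof.
move=> hf /(has_meanZ (-1)) hg; rewrite -mulN1r.
by apply: eq_has_mean (has_meanD hf hg) => x /=; rewrite mulN1r.
Qed.

Lemma has_mean0 : has_mean (cst 0) 0.
Proof. by split; [exact: integrable0|rewrite integral0]. Qed.

Lemma has_mean_sum I (s : seq I) (f : I -> T -> R) (r : I -> R) :
  (forall i, has_mean (f i) (r i)) ->
  has_mean (fun x => \sum_(i <- s) f i x) (\sum_(i <- s) r i).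
Proof.
move=> h; elim: s => [|i s ih].
  by rewrite big_nil; apply: eq_has_mean has_mean0 => x; rewrite big_nil.
rewrite big_cons; apply: eq_has_mean (has_meanD (h i) ih) => x /=.
by rewrite big_cons.
Qed.

Lemma has_mean_measurable f r : has_mean f r -> measurable_fun setT f.
Proof. by move=> [/measurable_int/measurable_EFinP]. Qed.

End has_mean.

Section has_mean_prob.
Context d (T : measurableType d) (R : realType) (P : probability T R).
Implicit Types f g : T -> R.

Lemma has_mean_cst (k : R) : has_mean P (cst k) k.
Proof.
split; first exact: finite_measure_integrable_cst.
by have := expectation_cst P k; rewrite unlock.
Qed.

Lemma has_mean_bounded f (M : R) :
  measurable_fun setT f -> (forall x, `|f x| <= M) -> exists r, has_mean P f r.
Proof.
move=> mf fM.
have If : P.-integrable setT (EFin \o f).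
  apply: (le_integrable _ _ _ (finite_measure_integrable_cst P M measurableT)).
  - exact: measurableT.
  - exact/measurable_EFinP.
  - by move=> x _; rewrite lee_fin (le_trans (fM x))// ler_norm.
exists (fine (\int[P]_x (f x)%:E)%E); split => //.
by rewrite fineK// integrable_fin_num.
Qed.

End has_mean_prob.

Section has_mean_transfer.
Context d1 d2 (T1 : measurableType d1) (T2 : measurableType d2) (R : realType).

Lemma has_mean_pushforward (mu : {measure set T1 -> \bar R}) (phi : T1 -> T2)
    (nu : {measure set T2 -> \bar R}) (f : T2 -> R) r :
  measurable_fun setT phi ->
  (forall B, measurable B -> mu (phi @^-1` B) = nu B) ->
  has_mean nu f r -> has_mean mu (f \o phi) r.
Proof.
move=> mphi E [If Ef].
have mf : measurable_fun setT (EFin \o f) by exact: measurable_int If.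
have EE : forall A, measurable A -> A `<=` setT -> pushforward mu phi A = nu A.
  by move=> A mA _; exact: E.
have I1 : mu.-integrable setT (EFin \o (f \o phi)).
  apply/integrableP; split.
    exact: (measurableT_comp mf mphi).
  rewrite -(@ge0_integral_pushforward _ _ _ _ _ _ mphi mu setT (fun y => `|(f y)%:E|%E))//.
  - by rewrite (eq_measure_integral nu)//; move/integrableP : If => [].
  - exact: measurableT_comp.
split => //.
rewrite -(@integral_pushforward _ _ _ _ _ _ mphi mu setT (EFin \o f))//.
by rewrite (eq_measure_integral nu)//.
Qed.

End has_mean_transfer.

Section has_mean_fubini.
Context d1 d2 (T1 : measurableType d1) (T2 : measurableType d2) (R : realType).
Variables (m1 : {sigma_finite_measure set T1 -> \bar R})
  (m2 : {sigma_finite_measure set T2 -> \bar R}).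
Implicit Types f : T1 * T2 -> R.

Lemma has_mean_fubini1 f (g : T1 -> R) r :
  (m1 \x m2)%E.-integrable setT (EFin \o f) ->
  (forall x, has_mean m2 (fun y => f (x, y)) (g x)) -> has_mean m1 g r ->
  has_mean (m1 \x m2)%E f r.
Proof.
move=> If fg [_ gr]; split => //.
rewrite -(fubini1 If) -gr; apply: eq_integral => x _.
by rewrite /fubini_F (fg x).2.
Qed.

Lemma has_mean_fubini2 f (g : T2 -> R) r :
  (m1 \x m2)%E.-integrable setT (EFin \o f) ->
  (forall y, has_mean m1 (fun x => f (x, y)) (g y)) -> has_mean m2 g r ->
  has_mean (m1 \x m2)%E f r.
Proof.
move=> If fg [_ gr]; split => //.
rewrite -(fubini2 If) -gr; apply: eq_integral => x _.
by rewrite /fubini_G (fg x).2.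
Qed.

(** Fubini read twice: the partial means [h] give the double integral, and the other partial means
    [g] inherit it. This exchanges an expectation with an average over an auxiliary normal
    variable. *)
Lemma has_mean_fubini f (g : T1 -> R) (h : T2 -> R) r :
  (m1 \x m2)%E.-integrable setT (EFin \o f) ->
  (forall x, has_mean m2 (fun y => f (x, y)) (g x)) ->
  (forall y, has_mean m1 (fun x => f (x, y)) (h y)) ->
  has_mean m2 h r -> has_mean m1 g r.
Proof.
move=> If fg fh hr; have [_ E] := has_mean_fubini2 If fh hr.
have gE : EFin \o g = fubini_F m2 (EFin \o f).
  by apply/funext => x /=; rewrite /fubini_F (fg x).2.
split; first by rewrite gE; exact: integrable_fubini_F.
by rewrite -E -(fubini1 If); apply: eq_integral => x _; rewrite /fubini_F (fg x).2.
Qed.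

(** Nonnegativity stands in for integrability on the product: Tonelli makes the double integral
    finite. Square integrability of F(X,Y) is obtained this way. *)
Lemma has_mean_tonelli2 f (g : T2 -> R) r :
  measurable_fun setT f -> (forall z, 0 <= f z) ->
  (forall y, has_mean m1 (fun x => f (x, y)) (g y)) -> has_mean m2 g r ->
  has_mean (m1 \x m2)%E f r.
Proof.
move=> mf f0 fg [Ig gr].
have mF : measurable_fun setT (EFin \o f) by exact/measurable_EFinP.
have E : (\int[m1 \x m2]_z (f z)%:E = r%:E)%E.
  rewrite (@fubini_tonelli2 _ _ _ _ _ m1 m2 (EFin \o f))//.
  by rewrite -gr; apply: eq_integral => y _; rewrite /fubini_G (fg y).2.
split => //; apply/integrableP; split => //.
under eq_integral do rewrite /= ger0_norm//.
by rewrite E ltry.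
Qed.

End has_mean_fubini.

(** * Normal laws on the line *)

Section normal.
Variable R : realType.
Notation leb := (@lebesgue_measure R).
Implicit Types (m s x t b : R) (f g G : R -> R).

Lemma is_derive_continuous f x df : is_derive x 1 f df -> {for x, continuous f}.
Proof.
by move=> fx; apply: differentiable_continuous; exact/derivable1_diffP.
Qed.

(** Integration by parts with vanishing boundary terms: on a symmetric interval around [m] the
    integral is a difference of end values of [G], which decay like 1/|x - m|, and dominated
    convergence passes to the whole line. *)
Lemma integral_derive_eq0 G g m C :
  (forall x, is_derive x 1 G (g x)) -> continuous g ->
  leb.-integrable setT (EFin \o g) ->
  (forall x, `|G x| * `|x - m| <= C) ->
  has_mean leb g 0.
Proof.
move=> Gg cg Ig GC; split => //.
(* [n.+1] keeps the interval nondegenerate at n = 0, as the fundamental theorem of calculus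
   requires. *)
pose D n := [set` `[m - n.+1%:R, m + n.+1%:R]] : set R.
have mg : measurable_fun setT (EFin \o g) by exact: measurable_int Ig.
have h1 n : measurable_fun setT ((EFin \o g) \_ (D n)).
  apply/(measurable_restrictT _ _).1; first exact: measurable_itv.
  exact: measurable_funTS.
have h2 : {ae leb, forall x, setT x ->
    ((EFin \o g) \_ (D n)) x @[n --> \oo] --> (EFin \o g) x}.
  apply: aeW => x _; apply: cvg_near_cst; near=> n.
  rewrite patchE mem_set// /D /= in_itv/=.
  have : `|x - m| <= n.+1%:R.
    rewrite -natr1; apply: ler_wpDr => //.
    by near: n; exact: nbhs_infty_ger.
  by rewrite ler_norml => /andP[] *; apply/andP; split; lra.
have h3 : {ae leb, forall x n, setT x ->
    (`|((EFin \o g) \_ (D n)) x| <= (abse \o (EFin \o g)) x)%E}.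
  apply: aeW => x n _; rewrite patchE; case: ifP => //= _.
  by rewrite normr0 lee_fin.
have [_ _] := @dominated_convergence _ _ _ leb setT measurableT _ _ _ h1 mg h2
  (integrable_abse Ig) h3.
have -> : (fun n => \int[leb]_x ((EFin \o g) \_ (D n)) x)%E =
   EFin \o (fun n => G (m + n.+1%:R) - G (m - n.+1%:R)).
  apply/funext => n; rewrite -integral_mkcond/= EFinB.
  have cG y : G x @[x --> y] --> G y by exact: is_derive_continuous (Gg y).
  apply: continuous_FTC2.
  - by rewrite ltrD2l -subr_gt0 opprK addr_gt0.
  - exact/continuous_subspaceT.
  - split; first by move=> x _; have [] := Gg x.
      exact/cvg_at_right_filter/cG.
    exact/cvg_at_left_filter/cG.
  - by move=> x _; rewrite derive1E; exact: derive_val.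
move=> cvi.
have cv0 : (G (m + n.+1%:R) - G (m - n.+1%:R)) @[n --> \oo] --> 0.
  apply: norm_cvg0.
  apply: (@squeeze_cvgr _ _ _ _ (cst 0) (fun n => (2 * C) * (n.+1%:R)^-1)).
  - near=> n; rewrite normr_ge0/=.
    rewrite ler_pdivlMr//.
    have := GC (m + n.+1%:R); have := GC (m - n.+1%:R).
    have -> : m - n.+1%:R - m = - n.+1%:R by ring.
    have -> : m + n.+1%:R - m = n.+1%:R by ring.
    rewrite normrN (ger0_norm (ler0n R n.+1)) => k1 k2.
    apply: le_trans (ler_wpM2r _ (ler_normB _ _)) _ => //.
    by rewrite mulrDl mulr2n mulrDl !mul1r lerD.
  - exact: cvg_cst.
  - rewrite -[X in _ --> X](mulr0 (2 * C)); apply: cvgMr.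
    exact: cvg_harmonic.
apply: (@cvg_unique _ (@ereal_hausdorff R) _ _ _ _ cvi).
by apply: cvg_EFin => //; exact: nearW.
Unshelve. all: by end_near. Qed.

(** The Radon-Nikodym derivative of the normal law and the explicit density have the same integral
    over every measurable set, hence agree almost everywhere. This settles nonnegative integrands; a
    signed [f] is split into positive and negative parts. *)
Lemma has_mean_normal_prob m s f r : s != 0 ->
  has_mean leb (fun x => f x * normal_pdf m s x) r ->
  measurable_fun setT f ->
  has_mean (normal_prob m s) f r.
Proof.
move=> s0 [If Ef] mf.
have RNE : ae_eq leb setT
    (Radon_Nikodym_SigmaFinite.f (normal_prob m s) leb)
    (fun x => (normal_pdf m s x)%:E).
  apply: integral_ae_eq => //.
  - apply: Radon_Nikodym_SigmaFinite.f_integrable.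
    exact: normal_prob_dominates.
  - by apply: measurableT_comp => //; exact: measurable_normal_pdf.
  - move=> A _ mA; rewrite -Radon_Nikodym_SigmaFinite.f_integral//.
    exact: normal_prob_dominates.
have ge0E (g : R -> \bar R) : measurable_fun setT g -> (forall x, 0 <= g x)%E ->
   (\int[normal_prob m s]_x g x = \int[leb]_x (g x * (normal_pdf m s x)%:E))%E.
  move=> mg g0.
  rewrite -(@Radon_Nikodym_SigmaFinite.change_of_variables _ _ _ _ leb)//; last first.
    exact: normal_prob_dominates.
  apply: ae_eq_integral => //.
  - apply: emeasurable_funM => //.
    apply: measurable_int (Radon_Nikodym_SigmaFinite.f_integrable _).
    exact: normal_prob_dominates.
  - apply: emeasurable_funM => //.
    by apply: measurableT_comp => //; exact: measurable_normal_pdf.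
  - exact: ae_eqe_mul2l.
have mF : measurable_fun setT (EFin \o f) by exact/measurable_EFinP.
have p0 := @normal_pdf_ge0 R m s.
have IN : (normal_prob m s).-integrable setT (EFin \o f).
  apply/integrableP; split => //.
  rewrite ge0E//; last exact: measurableT_comp.
  move/integrableP : If => [_]; congr (_ < _)%E; apply: eq_integral => x _ /=.
  by rewrite normrM EFinM (ger0_norm (p0 x)).
split=> //.
rewrite integralE ge0E; [|exact: measurable_funepos|by []].
rewrite ge0E; [|exact: measurable_funeneg|by []].
rewrite -Ef [RHS]integralE; congr (_ - _)%E; apply: eq_integral => x _.
- by rewrite !funeposE -!EFin_max -EFinM; congr EFin; rewrite maxr_pMl// mul0r.
- by rewrite !funenegE -!EFinN -!EFin_max -EFinM; congr EFin; rewrite maxr_pMl// mul0r mulNr.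
Qed.

(* [expR (3 u^2 / (8 s^2)) >= 1 + 3 u^2 / (8 s^2)] absorbs the quadratic factor at the
   cost of doubling the standard deviation. *)
Lemma normal_fun_bound m s x : s != 0 ->
  (1 + (x - m) ^+ 2) * normal_fun m s x <=
  (1 + 8 * s ^+ 2 / 3) * normal_fun m (2 * s) x.
Proof.
move=> s0; rewrite /normal_fun; set u := x - m.
have s2 : 0 < s ^+ 2 by rewrite exprn_even_gt0.
rewrite (_ : - u ^+ 2 / ((2 * s) ^+ 2 *+ 2) =
   3 * u ^+ 2 / (8 * s ^+ 2) + - u ^+ 2 / (s ^+ 2 *+ 2)); last first.
  by field.
rewrite expRD mulrA ler_wpM2r ?expR_ge0//.
have a0 : 0 < 8 * s ^+ 2 / 3 by rewrite divr_gt0// mulr_gt0.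
apply: (@le_trans _ _ ((1 + 8 * s ^+ 2 / 3) * (1 + 3 * u ^+ 2 / (8 * s ^+ 2)))); last first.
  by rewrite ler_pM2l ?expR_ge1Dx// addr_gt0.
rewrite -subr_ge0.
rewrite (_ : _ - _ = 8 * s ^+ 2 / 3 + 3 * u ^+ 2 / (8 * s ^+ 2)); last by field.
rewrite addr_ge0 ?(ltW a0)//.
by rewrite divr_ge0//; apply: mulr_ge0 => //; exact: sqr_ge0.
Qed.

(** Domination by a wider normal density yields both integrability under quadratic growth and decay
    at infinity, before any moment is known. *)
Lemma normal_pdf_bound m s : s != 0 -> exists K : R, forall x,
  (1 + (x - m) ^+ 2) * normal_pdf m s x <= K * normal_pdf m (2 * s) x.
Proof.
move=> s0; have s20 : 2 * s != 0 by rewrite mulf_neq0.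
exists ((1 + 8 * s ^+ 2 / 3) * normal_peak s / normal_peak (2 * s)) => x.
rewrite !normal_pdfE//.
rewrite [leRHS](_ : _ = normal_peak s * ((1 + 8 * s ^+ 2 / 3) * normal_fun m (2 * s) x)).
  by rewrite mulrCA ler_wpM2l ?normal_peak_ge0// normal_fun_bound.
have : normal_peak (2 * s) != 0 by rewrite gt_eqF// normal_peak_gt0.
by move: (normal_peak (2 * s)) => q q0; field.
Qed.

Lemma integrable_normal_pdf_le m s f K : s != 0 -> measurable_fun setT f ->
  (forall x, `|f x| <= K * (1 + (x - m) ^+ 2)) ->
  leb.-integrable setT (EFin \o (fun x => f x * normal_pdf m s x)).
Proof.
move=> s0 mf fK; have [L HL] := normal_pdf_bound m s0.
have K0 : 0 <= K.
  by have := fK m; rewrite subrr expr0n/= addr0 mulr1; exact: le_trans.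
have := integrableZl measurableT (K * L) (integrable_normal_pdf m (2 * s)).
apply: le_integrable => //.
  by apply/measurable_EFinP/measurable_funM => //; exact: measurable_normal_pdf.
move=> x _; rewrite /= lee_fin normrM (ger0_norm (normal_pdf_ge0 _ _ _)).
apply: le_trans (ler_wpM2r (normal_pdf_ge0 _ _ _) (fK x)) _.
by rewrite -mulrA (le_trans _ (ler_norm _))// -mulrA ler_wpM2l.
Qed.

Lemma is_derive_normal_pdf m s x : s != 0 ->
  is_derive x 1 (normal_pdf m s) (- ((x - m) / s ^+ 2) * normal_pdf m s x).
Proof.
move=> s0; rewrite normal_pdfE//.
have h : is_derive x (1 : R) (fun y : R => - (y - m) ^+ 2 / (s ^+ 2 *+ 2)) (- ((x - m) / s ^+ 2)).
  apply: is_derive_eq.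
  rewrite /GRing.scale/=.
  field.
  done.
have := is_deriveZ (normal_peak s) (is_derive1_comp (is_derive_expR _) h).
rewrite /GRing.scale/= => H; apply: (is_derive_eq H).
by rewrite /normal_fun mulrA mulrC.
Qed.

Lemma normal_pdf_tail m s : s != 0 ->
  exists C : R, forall x, (1 + (x - m) ^+ 2) * normal_pdf m s x <= C.
Proof.
move=> s0; have [K HK] := normal_pdf_bound m s0.
exists (`|K| * normal_peak (2 * s)) => x; apply: (le_trans (HK x)).
apply: (@le_trans _ _ (`|K| * normal_pdf m (2 * s) x)).
  by rewrite ler_wpM2r ?normal_pdf_ge0// ler_norm.
by rewrite ler_wpM2l// normal_pdf_ub// mulf_neq0.
Qed.

(** The density p satisfies p' = - (x - m) p / s^2, so (x - m) p is the derivative of - s^2 p. *)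
Lemma normal_prob_mean m s : s != 0 ->
  has_mean (normal_prob m s) (fun x => x - m) 0.
Proof.
move=> s0.
have mB : measurable_fun setT (fun x => x - m) by exact: measurable_funB.
apply: has_mean_normal_prob => //.
have Ip : leb.-integrable setT (EFin \o (fun x => (x - m) * normal_pdf m s x)).
  apply: (@integrable_normal_pdf_le _ _ _ 1) => // x.
  (* (|u| - 1)^2 >= 0 gives |u| <= 1 + u^2 for u = x - m; the same bound recurs below. *)
  rewrite mul1r; have := sqr_ge0 (`|x - m| - 1); rewrite sqrrB1 real_normK ?num_real//.
  by have := normr_ge0 (x - m); lra.
have [C HC] := normal_pdf_tail m s0.
apply: (@integral_derive_eq0 (fun x => - s ^+ 2 * normal_pdf m s x)
  (fun x => (x - m) * normal_pdf m s x) m (s ^+ 2 * C)) => //.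
- move=> x; have := is_deriveZ (- s ^+ 2) (is_derive_normal_pdf m x s0).
  move=> H; apply: (is_derive_eq H); rewrite /GRing.scale/=.
  by field.
- by move=> x; apply: cvgM; [apply: cvgB => //; exact: cvg_cst|exact: continuous_normal_pdf].
- move=> x; rewrite mulNr normrN normrM ger0_norm ?sqr_ge0// -mulrA ler_wpM2l ?sqr_ge0//.
  apply: le_trans (HC x); rewrite ger0_norm ?normal_pdf_ge0// mulrC ler_wpM2r ?normal_pdf_ge0//.
  have := sqr_ge0 (`|x - m| - 1); rewrite sqrrB1 real_normK ?num_real//.
  by have := normr_ge0 (x - m); lra.
Qed.

(** The derivative of - s^2 (x - m) p is (x - m)^2 p - s^2 p, and p has integral 1. *)
Lemma normal_prob_variance m s : s != 0 ->
  has_mean (normal_prob m s) (fun x => (x - m) ^+ 2) (s ^+ 2).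
Proof.
move=> s0.
have mB : measurable_fun setT (fun x => x - m) by exact: measurable_funB.
have mB2 : measurable_fun setT (fun x => (x - m) ^+ 2) by exact: measurable_funX.
have H1 : has_mean leb (fun x => s ^+ 2 * normal_pdf m s x) (s ^+ 2).
  rewrite -[X in has_mean _ _ X]mulr1; apply: has_meanZ; split.
    exact: integrable_normal_pdf.
  exact: integral_normal_pdf.
apply: has_mean_normal_prob => //.
have Ip : leb.-integrable setT (EFin \o (fun x => (x - m) ^+ 2 * normal_pdf m s x)).
  apply: (@integrable_normal_pdf_le _ _ _ 1) => // x.
  by rewrite mul1r ger0_norm ?sqr_ge0//; lra.
have H2 : has_mean leb (fun x => (x - m) ^+ 2 * normal_pdf m s x - s ^+ 2 * normal_pdf m s x) 0.
  have I2 := integrableB measurableT Ip H1.1.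
  have [C HC] := normal_pdf_tail m s0.
  apply: (@integral_derive_eq0 (fun x => - s ^+ 2 * ((x - m) * normal_pdf m s x))
    (fun x => (x - m) ^+ 2 * normal_pdf m s x - s ^+ 2 * normal_pdf m s x)
    m (s ^+ 2 * C)).
  - move=> x.
    have hd : is_derive x (1 : R) (fun y : R => y - m) 1.
      by apply: is_derive_eq; rewrite subr0.
    have := is_deriveZ (- s ^+ 2) (is_deriveM hd (is_derive_normal_pdf m x s0)).
    move=> H; apply: (is_derive_eq H); rewrite /GRing.scale/=.
    by field.
  - have cm : continuous (fun x => x - m).
      by move=> x; apply: cvgB => //; exact: cvg_cst.
    move=> x; apply: cvgB; apply: cvgM; try exact: continuous_normal_pdf.
      rewrite expr2; apply: cvgM; exact: cm.
    exact: cvg_cst.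
  - by apply: eq_integrable I2.
  - move=> x; rewrite mulNr normrN normrM ger0_norm ?sqr_ge0// -mulrA ler_wpM2l ?sqr_ge0//.
    apply: le_trans (HC x); rewrite normrM (ger0_norm (normal_pdf_ge0 _ _ _)).
    rewrite mulrAC ler_wpM2r ?normal_pdf_ge0//.
    by rewrite -expr2 real_normK ?num_real//; lra.
have := has_meanD H2 H1; rewrite add0r; apply: eq_has_mean => x /=.
by rewrite subrK.
Qed.

(** As a function of the frequency a, the integral h satisfies h' = - s^2 a h, so h(a) exp(s^2 a^2 /
    2) is constant, equal to cos b at a = 0. The phase [b] lets the real cosine carry the whole
    characteristic function. *)
Lemma normal_prob_cos m s t b : s != 0 ->
  has_mean (normal_prob m s) (fun x => cos (t * (x - m) + b))
    (expR (- 2^-1 * s ^+ 2 * t ^+ 2) * cos b).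
Proof.
move=> s0.
have mB : measurable_fun setT (fun x => x - m) by exact: measurable_funB.
have mL a : measurable_fun setT (fun x => a * (x - m) + b).
  by apply: measurable_funD => //; exact: measurable_funM.
have mC a : measurable_fun setT (fun x => cos (a * (x - m) + b)).
  by apply: measurableT_comp (mL a) => //; apply: continuous_measurable_fun; exact: continuous_cos.
have mS a : measurable_fun setT (fun x => sin (a * (x - m) + b)).
  by apply: measurableT_comp (mL a) => //; apply: continuous_measurable_fun; exact: continuous_sin.
have IC a : leb.-integrable setT
    (EFin \o (fun x => cos (a * (x - m) + b) * normal_pdf m s x)).
  apply: (@integrable_normal_pdf_le _ _ _ 1) => // x.
  by rewrite mul1r (le_trans (cos_max _))// lerDl sqr_ge0.
have IS a : leb.-integrable setT
    (EFin \o (fun x => (x - m) * sin (a * (x - m) + b) * normal_pdf m s x)).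
  apply: (@integrable_normal_pdf_le _ _ _ 1) => //.
    by apply: measurable_funM.
  move=> x; rewrite mul1r normrM (le_trans (ler_wpM2l _ (sin_max _)))// mulr1.
  have := sqr_ge0 (`|x - m| - 1); rewrite sqrrB1 real_normK ?num_real//.
  by have := normr_ge0 (x - m); lra.
have IG : leb.-integrable setT (EFin \o (fun x => `|x - m| * normal_pdf m s x)).
  apply: (@integrable_normal_pdf_le _ _ _ 1) => //; first exact: measurableT_comp.
  move=> x; rewrite mul1r normr_id.
  have := sqr_ge0 (`|x - m| - 1); rewrite sqrrB1 real_normK ?num_real//.
  by have := normr_ge0 (x - m); lra.
pose h a := (\int[leb]_x (cos (a * (x - m) + b) * normal_pdf m s x)).
have dcos a x : is_derive a (1 : R) (fun a => cos (a * (x - m) + b) * normal_pdf m s x)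
    (- ((x - m) * sin (a * (x - m) + b) * normal_pdf m s x)).
  have hl : is_derive a (1 : R) (fun a => a * (x - m) + b) (x - m).
    apply: is_derive_eq; rewrite /GRing.scale/=.
    by rewrite mulr0 add0r addr0 mulr1.
  have := is_deriveM (is_derive1_comp (is_derive_cos _) hl)
    (is_derive_cst (normal_pdf m s x) a 1).
  move=> H; apply: (is_derive_eq H); rewrite /GRing.scale/=.
  by rewrite mulr0 add0r; ring.
have dpart a x : partial1of2 (fun a x => cos (a * (x - m) + b) * normal_pdf m s x) a x =
    - ((x - m) * sin (a * (x - m) + b) * normal_pdf m s x).
  by rewrite partial1of2E; exact: derive_val.
(* integration by parts turns the derivative of h into - s^2 a h(a) *)
have parts a :
    (\int[leb]_x ((x - m) * sin (a * (x - m) + b) * normal_pdf m s x)) = s ^+ 2 * a * h a.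
  have I1 := integrableB measurableT (IS a) (integrableZl measurableT (s ^+ 2 * a) (IC a)).
  have [C HC] := normal_pdf_tail m s0.
  have [_ E] : has_mean leb (fun x => (x - m) * sin (a * (x - m) + b) * normal_pdf m s x
      - (s ^+ 2 * a) * (cos (a * (x - m) + b) * normal_pdf m s x)) 0.
    apply: (@integral_derive_eq0
      (fun x => - s ^+ 2 * (sin (a * (x - m) + b) * normal_pdf m s x))
      (fun x => (x - m) * sin (a * (x - m) + b) * normal_pdf m s x
        - (s ^+ 2 * a) * (cos (a * (x - m) + b) * normal_pdf m s x))
      m (s ^+ 2 * C)).
    - move=> x.
      have hl : is_derive x (1 : R) (fun x => a * (x - m) + b) a.
        apply: is_derive_eq; rewrite /GRing.scale/=.
        by rewrite subr0 mulr1 addr0.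
      have := is_deriveZ (- s ^+ 2) (is_deriveM
        (is_derive1_comp (is_derive_sin _) hl) (is_derive_normal_pdf m x s0)).
      move=> H; apply: (is_derive_eq H); rewrite /GRing.scale/=.
      by field.
    - have cl : continuous (fun x => a * (x - m) + b).
        move=> x; apply: cvgD; last exact: cvg_cst.
        by apply: cvgM; [exact: cvg_cst|apply: cvgB => //; exact: cvg_cst].
      move=> x; apply: cvgB.
        apply: cvgM; last exact: continuous_normal_pdf.
        apply: cvgM; first by apply: cvgB => //; exact: cvg_cst.
        by apply: (cvg_comp (fun x => a * (x - m) + b) sin); [exact: cl|exact: continuous_sin].
      apply: cvgM; first exact: cvg_cst.
      apply: cvgM; last exact: continuous_normal_pdf.
      by apply: (cvg_comp (fun x => a * (x - m) + b) cos); [exact: cl|exact: continuous_cos].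
    - by apply: eq_integrable I1.
    - move=> x; rewrite mulNr normrN normrM ger0_norm ?sqr_ge0// -mulrA ler_wpM2l ?sqr_ge0//.
      apply: le_trans (HC x); rewrite normrM (ger0_norm (normal_pdf_ge0 _ _ _)).
      rewrite mulrAC ler_wpM2r ?normal_pdf_ge0//.
      apply: le_trans (ler_wpM2r _ (sin_max _)) _ => //; rewrite mul1r.
      have := sqr_ge0 (`|x - m| - 1); rewrite sqrrB1 real_normK ?num_real//.
      by have := normr_ge0 (x - m); lra.
  move: E; under eq_integral do rewrite EFinB; rewrite integralB_EFin//; last first.
    by apply: eq_integrable (integrableZl measurableT (s ^+ 2 * a) (IC a)).
  rewrite /Rintegral; under [X in (_ - X)%E]eq_integral do rewrite EFinM.
  rewrite (integralZl measurableT (IC a)).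
  have := integrable_fin_num measurableT (IS a); have := integrable_fin_num measurableT (IC a).
  rewrite /h /Rintegral /=; case: (\int[leb]_x _)%E => // r1 _.
  by case: (\int[leb]_x _)%E => // r2 _ /= /eqP; rewrite eqe subr_eq0 => /eqP.
(* Differentiation under the integral sign near [a]: the derivatives are dominated by |x - m| p,
   which does not depend on the frequency. *)
have dh a : is_derive a (1 : R) h (- s ^+ 2 * a * h a).
  have Ia : `]a - 1, a + 1[%classic a by rewrite /= in_itv/=; apply/andP; split; lra.
  have h1 x : `]a - 1, a + 1[%classic x -> leb.-integrable setT
     (EFin \o (fun y => cos (x * (y - m) + b) * normal_pdf m s y)) by [].
  have h2 x y : `]a - 1, a + 1[%classic x -> setT y ->
     derivable ((fun a x => cos (a * (x - m) + b) * normal_pdf m s x) ^~ y) x 1.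
    by move=> _ _; have [] := dcos x y.
  have h3 y : 0 <= `|y - m| * normal_pdf m s y by rewrite mulr_ge0// normal_pdf_ge0.
  have h4 x y : `]a - 1, a + 1[%classic x -> setT y ->
     `|partial1of2 (fun a x => cos (a * (x - m) + b) * normal_pdf m s x) x y| <=
     `|y - m| * normal_pdf m s y.
    move=> _ _; rewrite dpart normrN normrM (ger0_norm (normal_pdf_ge0 _ _ _)).
    rewrite ler_wpM2r ?normal_pdf_ge0// normrM -[leRHS]mulr1.
    by rewrite ler_wpM2l// sin_max.
  have D1 := derivable_under_integral measurableT Ia h1 h2 h3 IG h4.
  have D2 := differentiation_under_integral measurableT Ia h1 h2 h3 IG h4.
  apply: DeriveDef => //; rewrite -derive1E D2.
  under eq_Rintegral do rewrite dpart -mulN1r.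
  by rewrite RintegralZl// parts mulN1r !mulNr.
have dE a : is_derive a (1 : R) (fun a => h a * expR (2^-1 * s ^+ 2 * a ^+ 2)) 0.
  have hq : is_derive a (1 : R) (fun a => 2^-1 * s ^+ 2 * a ^+ 2) (s ^+ 2 * a).
    apply: is_derive_eq; rewrite /GRing.scale/=.
    by field.
  have := is_deriveM (dh a) (is_derive1_comp (is_derive_expR _) hq).
  move=> H; apply: (is_derive_eq H); rewrite /GRing.scale/=.
  by ring.
have := is_derive_0_is_cst t 0 dE.
rewrite expr0n/= mulr0 expR0 mulr1 => E.
have h0 : h 0 = cos b.
  rewrite /h /Rintegral.
  under eq_integral do rewrite mul0r add0r EFinM.
  rewrite (integralZl measurableT (integrable_normal_pdf m s)) integral_normal_pdf.
  by rewrite mule1.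
have ht : h t = expR (- 2^-1 * s ^+ 2 * t ^+ 2) * cos b.
  by rewrite -h0 -E mulrCA -expRD !mulNr addNr expR0 mulr1.
apply: has_mean_normal_prob => //; split => //.
by rewrite -ht /h /Rintegral fineK//; exact: integrable_fin_num (IC t).
Qed.

End normal.

(** * Gaussian vectors *)

Section gaussian_moments.
Context d (T : measurableType d) (R : realType) (P : probability T R).
Implicit Types (X Y Z f g : T -> R).

(** All that is kept of a normal law. Frequency 1 suffices because other frequencies arise by
    rescaling [Z], and v = 0 covers point masses. *)
Definition gaussian_moments Z (m v : R) : Prop :=
  [/\ 0 <= v, has_mean P Z m, has_mean P (fun w => (Z w - m) ^+ 2) v &
    forall b, has_mean P (fun w => cos (Z w - m + b)) (expR (- 2^-1 * v) * cos b)].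

Lemma gaussian_rv_moments Z : measurable_fun setT Z -> gaussian_rv P Z ->
  exists m v, gaussian_moments Z m v.
Proof.
move=> mZ [m [s [s0 H]]].
have mD : measurable_fun setT (fun x : R => x - m) by exact: measurable_funB.
have mC b : measurable_fun setT (fun x : R => cos (x - m + b)).
  have mcos : measurable_fun setT (@cos R).
    by apply: continuous_measurable_fun; exact: continuous_cos.
  by apply: (measurableT_comp mcos); exact: measurable_funD.
exists m, (s ^+ 2).
have [s00|sN0] := eqVneq s 0.
  have HD (f : R -> R) : measurable_fun setT f -> has_mean P (f \o Z) (f m).
    move=> mf; apply: (@has_mean_pushforward _ _ _ _ _ _ _ (\d_m)) => //.
      by move=> B mB; have := H B mB; rewrite s00 eqxx.
    split; last first.
      rewrite integral_dirac//.
      2: exact/measurable_EFinP.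
      by rewrite /= diracE in_setT mul1e.
    apply/integrableP; split; first exact/measurable_EFinP.
    rewrite integral_dirac//=; last first.
      by apply/measurable_EFinP; exact: measurableT_comp.
    by rewrite diracE in_setT mul1e ltry.
  split.
  - exact: sqr_ge0.
  - exact: (HD id).
  - have := HD (fun x => (x - m) ^+ 2) (measurable_funX 2 mD).
    by rewrite subrr s00.
  - move=> b; have := HD _ (mC b).
    by rewrite subrr add0r s00 expr0n/= mulr0 expR0 mul1r.
have HN (f : R -> R) r : has_mean (normal_prob m s) f r -> has_mean P (f \o Z) r.
  move=> h; apply: (@has_mean_pushforward _ _ _ _ _ _ _ (normal_prob m s)) => //.
  by move=> B mB; have := H B mB; rewrite (negbTE sN0).
split.
- exact: sqr_ge0.
- have := HN _ _ (has_meanD (normal_prob_mean m sN0) (has_mean_cst (normal_prob m s) m)).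
  by rewrite add0r; apply: eq_has_mean => w /=; rewrite subrK.
- exact: HN (normal_prob_variance m sN0).
- move=> b; have := HN _ _ (normal_prob_cos m 1 b sN0).
  rewrite expr1n mulr1.
  by apply: eq_has_mean => w /=; rewrite mul1r.
Qed.

Lemma has_mean_sqr_mul f g a b : measurable_fun setT f -> measurable_fun setT g ->
  has_mean P (fun w => f w ^+ 2) a -> has_mean P (fun w => g w ^+ 2) b ->
  exists c, has_mean P (fun w => f w * g w) c.
Proof.
move=> mf mg [If _] [Ig _].
have I : P.-integrable setT (EFin \o (fun w => f w * g w)).
  apply: (le_integrable _ _ _ (integrableD measurableT If Ig)) => //.
    by apply/measurable_EFinP; exact: measurable_funM.
  move=> x _; rewrite /= lee_fin [leRHS]ger0_norm ?addr_ge0 ?sqr_ge0// ler_norml.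
  have := sqr_ge0 (f x - g x); have := sqr_ge0 (f x + g x).
  have := sqr_ge0 (f x); have := sqr_ge0 (g x).
  by rewrite sqrrD sqrrB => *; apply/andP; split; lra.
exists (fine (\int[P]_w (f w * g w)%:E)%E); split => //.
by rewrite fineK//; exact: integrable_fin_num I.
Qed.

(** The covariance hypothesis only equates extended reals; integrability of the product has to come
    from the two finite variances. *)
Lemma gaussian_moments_cov X Y a b va vb c :
  gaussian_moments X a va -> gaussian_moments Y b vb -> covariance P X Y = c%:E ->
  has_mean P (fun w => (X w - a) * (Y w - b)) c.
Proof.
move=> [_ hX hX2 _] [_ hY hY2 _] cXY.
have mX := has_mean_measurable hX; have mY := has_mean_measurable hY.
have [|| c' hc'] := has_mean_sqr_mul _ _ hX2 hY2.
- exact: measurable_funB.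
- exact: measurable_funB.
suff -> : c = c' by [].
apply: EFin_inj; rewrite -cXY -hc'.2 unlock [in LHS]unlock.
by rewrite hX.2 hY.2.
Qed.

(** Each projection is univariate normal with unknown parameters; expanding the sum and its square
    identifies them with the sum of the c_i m_i and with c S c^T, since means are unique. *)
Lemma gaussian_vector_cos n (Z : 'I_n -> T -> R) (S : 'M[R]_n) :
  (forall i, measurable_fun setT (Z i)) ->
  (forall c : 'I_n -> R, gaussian_rv P (fun x => \sum_(i < n) c i * Z i x)) ->
  (forall i j, covariance P (Z i) (Z j) = (S i j)%:E) ->
  exists m : 'I_n -> R, forall (c : 'rV[R]_n) (b : R),
    has_mean P (fun w => cos (\sum_(i < n) c 0 i * Z i w + b))
      (expR (- 2^-1 * (c *m S *m c^T) 0 0) * cos (\sum_(i < n) c 0 i * m i + b)).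
Proof.
move=> mZ gZ cZ.
have mL (c : 'I_n -> R) : measurable_fun setT (fun x => \sum_(i < n) c i * Z i x).
  apply: measurable_sum => i; exact: measurable_funM.
have ZM i : exists mv : R * R, gaussian_moments (Z i) mv.1 mv.2.
  have := gZ (fun j => (j == i)%:R).
  have -> : (fun x => \sum_(j < n) (j == i)%:R * Z j x) = Z i.
    apply/funext => x; rewrite (bigD1 i)//= eqxx mul1r big1 ?addr0// => j /negbTE ->.
    by rewrite mul0r.
  by move=> /(gaussian_rv_moments (mZ i))[m [v h]]; exists (m, v).
have [mv Hmv] := choice ZM.
exists (fun i => (mv i).1) => c b.
have [m [v [_ h1 h2 h3]]] := gaussian_rv_moments (mL (c 0)) (gZ (c 0)).
have mE : m = \sum_(i < n) c 0 i * (mv i).1.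
  apply: has_mean_uniq h1 _; apply: has_mean_sum => i; apply: has_meanZ.
  by have [] := Hmv i.
have vE : v = (c *m S *m c^T) 0 0.
  apply: has_mean_uniq h2 _.
  have := has_mean_sum (index_enum 'I_n) (fun i => has_mean_sum (index_enum 'I_n)
     (fun j => has_meanZ (c 0 i * c 0 j) (gaussian_moments_cov (Hmv i) (Hmv j) (cZ i j)))).
  have -> : \sum_i \sum_j c 0 i * c 0 j * S i j = (c *m S *m c^T) 0 0.
    rewrite exchange_big mxE; apply: eq_bigr => j _.
    rewrite !mxE big_distrl; apply: eq_bigr => i _ /=.
    by rewrite mulrAC.
  apply: eq_has_mean => w; rewrite mE -sumrB expr2 big_distrl; apply: eq_bigr => i _ /=.
  rewrite big_distrr; apply: eq_bigr => j _ /=.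
  by rewrite -!mulrBr; ring.
(* The phase m + b undoes the centring in [gaussian_moments]. *)
have := h3 (m + b); rewrite vE mE; apply: eq_has_mean => w.
by rewrite addrA subrK.
Qed.

End gaussian_moments.

Section gaussian_quadratic_form.
Context d (T : measurableType d) (R : realType) (P : probability T R).

(** Completing the square: times the standard density, the integrand is a constant multiple of the
    normal density with variance s^2 = 1 / (1 + al) and mean - be s^2. *)
Lemma normal_prob_expR_quad (al be ga : R) : 0 <= al ->
  has_mean (normal_prob 0 1) (fun t => expR (- 2^-1 * (al * t ^+ 2 + 2 * be * t + ga)))
    ((1 + al) `^ (- 2^-1) * expR (- 2^-1 * (ga - be ^+ 2 / (1 + al)))).
Proof.
move=> al0; have al1 : 0 < 1 + al by rewrite ltr_wpDr.
apply: has_mean_normal_prob; first exact: oner_neq0; last first.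
  apply: measurableT_comp => //; apply: measurable_funM => //.
  apply: measurable_funD => //; apply: measurable_funD => //.
  by apply: measurable_funM => //; exact: measurable_funX.
set s := (1 + al) `^ (- 2^-1).
have s_gt0 : 0 < s by exact: powR_gt0.
have s2 : s ^+ 2 = (1 + al)^-1.
  rewrite -powR_mulrn ?ltW// -powRrM mulNr mulVf// powR_inv1//.
  exact: ltW.
have H : has_mean lebesgue_measure (normal_pdf (- be * s ^+ 2) s) 1.
  by split; [exact: integrable_normal_pdf|exact: integral_normal_pdf].
have := has_meanZ (s * expR (- 2^-1 * (ga - be ^+ 2 / (1 + al)))) H.
rewrite mulr1; apply: eq_has_mean => t.
rewrite !normal_pdfE ?gt_eqF// /normal_fun /normal_peak.
rewrite expr1n mul1r -mulrnAr sqrtrM ?sqr_ge0// sqrtr_sqr gtr0_norm// invfM.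
have -> : s * expR (- 2^-1 * (ga - be ^+ 2 / (1 + al))) *
  (s^-1 / Num.sqrt (pi *+ 2) * expR (- (t - - be * s ^+ 2) ^+ 2 / (s ^+ 2 *+ 2))) =
  (Num.sqrt (pi *+ 2))^-1 * expR (- 2^-1 * (ga - be ^+ 2 / (1 + al))
    - (t - - be * s ^+ 2) ^+ 2 / (s ^+ 2 *+ 2)).
  rewrite expRD -[in X in _ = _ * (_ * expR X)]mulNr.
  set e1 := expR _; set e2 := expR _; move: (Num.sqrt _)^-1 e1 e2 => q e1 e2.
  by have s0 : s != 0 by [rewrite gt_eqF]; field.
rewrite [RHS]mulrCA -expRD; congr (_ * expR _).
rewrite s2; have : 1 + al != 0 by rewrite gt_eqF.
by move=> ?; field.
Qed.

(* Each factor [expR (- L^2 / 2)] is the mean of [cos (t * L)] over a standard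
   normal [t]; integrating it out replaces [C] by a Schur complement. *)
Lemma gaussian_quadratic_form n (L : 'I_n -> T -> R) (C : 'M[R]_n) (g : T -> R) (m : R) :
  (forall i, measurable_fun setT (L i)) ->
  measurable_fun setT g -> (forall w, 0 <= g w <= 1) ->
  C^T = C -> (forall a : 'rV[R]_n, 0 <= (a *m C *m a^T) 0 0) ->
  (forall a : 'rV[R]_n, has_mean P (fun w => g w * cos (\sum_(i < n) a 0 i * L i w))
     (m * expR (- 2^-1 * (a *m C *m a^T) 0 0))) ->
  0 < \det (1%:M + C) /\
  has_mean P (fun w => g w * expR (- 2^-1 * \sum_(i < n) L i w ^+ 2))
    (m * \det (1%:M + C) `^ (- 2^-1)).
Proof.
(* The weight [g] is generalized because it collects the factors already peeled off; [H] at a = 0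
   says that [m] is its mean. *)
elim: n L C g m => [|n IHn] L C g m mL mg g01 Csym Cpsd H.
  rewrite det_mx00 ltr01 powR1; split => //.
  have := H 0; rewrite !mul0mx mxE mulr0 expR0.
  by apply: eq_has_mean => w; rewrite !big_ord0 mulr0 cos0 expR0.
rewrite -[n.+1]/(1 + n)%N in L C mL Csym Cpsd H *.
pose L0 := L (lshift n 0); pose L' j := L (rshift 1 j).
pose al := C (lshift n 0) (lshift n 0).
pose B := ursubmx C; pose D := drsubmx C.
have Dsym : D^T = D by rewrite /D trmx_drsub Csym.
have dlE : dlsubmx C = B^T by rewrite /B trmx_ursub Csym.
have CE : C = block_mx al%:M B B^T D.
  rewrite -[C in LHS]submxK dlE; congr (block_mx _ _ _ _).
  by apply/matrixP => i j; rewrite !ord1 !mxE eqxx mulr1n.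
have quadE t (a : 'rV[R]_n) :
   (row_mx t%:M a *m C *m (row_mx t%:M a)^T) 0 0 =
   al * t ^+ 2 + 2 * (B *m a^T) 0 0 * t + (a *m D *m a^T) 0 0.
  rewrite CE tr_row_mx mul_row_block mul_row_col mulmxDl [in X in _ + X]mulmxDl.
  rewrite -[t%:M *m B *m _]mulmxA.
  have -> : a *m B^T = (B *m a^T)^T by rewrite trmx_mul trmxK.
  rewrite tr_scalar_mx !mul_scalar_mx !mul_mx_scalar.
  have [b ->] : exists b : R, B *m a^T = b%:M by eexists; exact: mx11_scalar.
  have [e ->] : exists e : R, a *m D *m a^T = e%:M by eexists; exact: mx11_scalar.
  by rewrite !mxE eqxx !mulr1n; ring.
have al0 : 0 <= al.
  have := Cpsd (row_mx 1%:M 0); rewrite quadE trmx0 mulmx0 mul0mx mulmx0 !mxE.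
  by rewrite mulr0 mul0r !addr0 expr1n mulr1.
have al1 : 1 + al != 0 by rewrite gt_eqF// ltr_wpDr.
have sumE t (a : 'rV[R]_n) w :
   \sum_(i < 1 + n) (row_mx t%:M a) 0 i * L i w = t * L0 w + \sum_(j < n) a 0 j * L' j w.
  rewrite big_split_ord/= big_ord1 row_mxEl mxE eqxx mulr1n; congr (_ + _).
  by apply: eq_bigr => j _; rewrite row_mxEr.
(* [1%:M + C'] is the Schur complement of the pivot [1 + al] in [1%:M + C]. *)
pose C' := D - (1 + al)^-1 *: (B^T *m B).
have quadE' (a : 'rV[R]_n) :
  (a *m C' *m a^T) 0 0 = (a *m D *m a^T) 0 0 - (B *m a^T) 0 0 ^+ 2 / (1 + al).
  rewrite /C' mulmxBr mulmxBl -scalemxAr -scalemxAl.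
  have -> : a *m (B^T *m B) *m a^T = (B *m a^T)^T *m (B *m a^T).
    by rewrite trmx_mul trmxK !mulmxA.
  have [b ->] : exists b : R, B *m a^T = b%:M by eexists; exact: mx11_scalar.
  have [e ->] : exists e : R, a *m D *m a^T = e%:M by eexists; exact: mx11_scalar.
  by rewrite tr_scalar_mx mul_scalar_mx !mxE eqxx !mulr1n; field.
pose g' w := g w * expR (- 2^-1 * L0 w ^+ 2).
have mL0 : measurable_fun setT L0 by exact: mL.
have mg' : measurable_fun setT g'.
  apply: measurable_funM => //; apply: measurableT_comp => //.
  by apply: measurable_funM => //; exact: measurable_funX.
have g'01 w : 0 <= g' w <= 1.
  have /andP[g0 g1] := g01 w.
  rewrite /g' mulr_ge0 ?expR_ge0//= mulr_ile1 ?expR_ge0//.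
  by rewrite -expR0 ler_expR mulNr oppr_le0 mulr_ge0 ?sqr_ge0.
have [| | | | | |det0 HH] := IHn L' C' g' (m * (1 + al) `^ (- 2^-1)).
- by move=> i; exact: mL.
- exact: mg'.
- exact: g'01.
- by rewrite /C' linearB/= linearZ/= trmx_mul trmxK Dsym.
- move=> a; rewrite quadE'.
  set be := (B *m a^T) 0 0.
  (* t = - be / (1 + al) minimizes t^2 plus the form of [C] at (t, a), and the minimum is the form
     of [C'] at a. So the latter exceeds a value of the form of [C] by t^2. *)
  have := Cpsd (row_mx (- be / (1 + al))%:M a); rewrite quadE -/be => h.
  apply: le_trans h _; rewrite -subr_ge0.
  rewrite [leRHS](_ : _ = (be / (1 + al)) ^+ 2); last by field.
  exact: sqr_ge0.
- move=> a; pose M w := \sum_(j < n) a 0 j * L' j w.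
  have mM : measurable_fun setT M.
    by apply: measurable_sum => j; apply: measurable_funM => //; exact: mL.
  have mcos : measurable_fun setT (@cos R).
    by apply: continuous_measurable_fun; exact: continuous_cos.
  (* Averaging [f] over t gives g' cos(M). Averaging over w uses [H] at (t, a) and (-t, a), because
     2 cos(t L0) cos(M) = cos(t L0 + M) + cos(- t L0 + M). Fubini equates the two results. *)
  pose f (z : T * measurableTypeR R) := g z.1 * (cos (z.2 * L0 z.1) * cos (M z.1)).
  have mf : measurable_fun setT f.
    apply: measurable_funM; first exact: measurableT_comp.
    apply: measurable_funM.
      apply: measurableT_comp => //; apply: measurable_funM => //.
      exact: (measurableT_comp mL0).
    by apply: measurableT_comp => //; exact: (measurableT_comp mM).
  have fb z : `|f z| <= 1.
    rewrite /f !normrM; have /andP[g0 g1] := g01 z.1.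
    by rewrite ger0_norm// mulr_ile1 ?mulr_ge0// mulr_ile1// cos_max.
  have [rr [If _]] := has_mean_bounded (P \x normal_prob 0 1)%E mf fb.
  have h1 w : has_mean (normal_prob 0 1) (fun t => f (w, t)) (g' w * cos (M w)).
    have := has_meanZ (g w * cos (M w)) (normal_prob_cos 0 (L0 w) 0 (oner_neq0 R)).
    have -> : g w * cos (M w) * (expR (- 2^-1 * 1 ^+ 2 * L0 w ^+ 2) * cos 0) = g' w * cos (M w).
      by rewrite cos0 expr1n !mulr1 mulrAC.
    by apply: eq_has_mean => t; rewrite /f/= subr0 addr0 (mulrC t); ring.
  have h2 t : has_mean P (fun w => f (w, t))
    (m * 2^-1 * (expR (- 2^-1 * (al * t ^+ 2 + 2 * (B *m a^T) 0 0 * t + (a *m D *m a^T) 0 0)) +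
       expR (- 2^-1 * (al * t ^+ 2 + 2 * (- (B *m a^T) 0 0) * t + (a *m D *m a^T) 0 0)))).
    have := has_meanZ 2^-1 (has_meanD (H (row_mx t%:M a)) (H (row_mx (- t)%:M a))).
    rewrite !quadE -mulrDr mulrCA mulrA sqrrN mulrN -mulNr -mulrN.
    apply: eq_has_mean => w /=; rewrite !sumE mulNr -/(M w) /f/=.
    by rewrite !cosD sinN cosN; field.
  have h3 := has_meanZ (m * 2^-1) (has_meanD
      (normal_prob_expR_quad ((B *m a^T) 0 0) ((a *m D *m a^T) 0 0) al0)
      (normal_prob_expR_quad (- (B *m a^T) 0 0) ((a *m D *m a^T) 0 0) al0)).
  have := has_mean_fubini If h1 h2 h3.
  rewrite sqrrN -quadE' => hh.
  set r := (X in has_mean _ _ X) in hh.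
  suff -> : m * (1 + al) `^ (- 2^-1) * expR (- 2^-1 * (a *m C' *m a^T) 0 0) = r by [].
  by rewrite /r; field.
have detE : \det (1%:M + C) = (1 + al) * \det (1%:M + C').
  have -> : 1%:M + C = block_mx (1 + al)%:M B B^T (1%:M + D) :> 'M[R]_(1 + n).
    rewrite [in LHS]CE [X in X + _ = _]scalar_mx_block add_block_mx !add0r.
    congr (block_mx _ _ _ _).
    by rewrite -raddfD.
  have E : block_mx 1%:M 0 (- (1 + al)^-1 *: B^T) 1%:M *m
     block_mx (1 + al)%:M B B^T (1%:M + D) = block_mx (1 + al)%:M B 0 (1%:M + C').
    rewrite mulmx_block !mul1mx !mul0mx !addr0; congr (block_mx _ _ _ _).
      by rewrite mul_mx_scalar scalerA mulrN mulfV// scaleN1r addNr.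
    by rewrite -scalemxAl /C' scaleNr addrC addrA.
  have := congr1 determinant E.
  by rewrite det_mulmx det_lblock !det1 !mul1r det_ublock det_scalar1.
have al2 : 0 < 1 + al by rewrite ltr_wpDr.
rewrite detE; split; first exact: mulr_gt0.
rewrite powRM ?ltW// mulrA; apply: eq_has_mean HH => w.
by rewrite /g' -mulrA -expRD -mulrDr big_split_ord/= big_ord1.
Qed.

End gaussian_quadratic_form.

(** * Positive definite matrices *)

Section spd.
Variable R : realType.

(** Cholesky factorization by induction: the Schur complement of the first pivot is again positive
    definite, and its factor is completed by a row divided by the square root of the pivot. *)
Lemma spd_mx_cholesky n (S : 'M[R]_n) : spd_mx S ->
  exists2 K : 'M[R]_n, K \in unitmx & S = K^T *m K.
Proof.
elim: n S => [|n IHn] S.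
  move=> _; exists 1%:M; first exact: unitmx1.
  by rewrite [S]flatmx0 [RHS]flatmx0.
rewrite -[n.+1]/(1 + n)%N in S * => -[Ssym Spos].
pose al := S (lshift n 0) (lshift n 0).
pose B := ursubmx S; pose D := drsubmx S.
have Dsym : D^T = D by rewrite /D trmx_drsub Ssym.
have dlE : dlsubmx S = B^T by rewrite /B trmx_ursub Ssym.
have SE : S = block_mx al%:M B B^T D.
  rewrite -[S in LHS]submxK dlE; congr (block_mx _ _ _ _).
  by apply/matrixP => i j; rewrite !ord1 !mxE eqxx mulr1n.
have quadE t (a : 'cV[R]_n) :
   ((col_mx t%:M a)^T *m S *m (col_mx t%:M a)) 0 0 =
   al * t ^+ 2 + 2 * (B *m a) 0 0 * t + (a^T *m D *m a) 0 0.
  rewrite SE tr_col_mx mul_row_block mul_row_col mulmxDl [in X in _ + X]mulmxDl.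
  rewrite -[t%:M^T *m B *m _]mulmxA.
  have -> : a^T *m B^T = (B *m a)^T by rewrite trmx_mul.
  rewrite tr_scalar_mx !mul_scalar_mx !mul_mx_scalar.
  have [b ->] : exists b : R, B *m a = b%:M by eexists; exact: mx11_scalar.
  have [e ->] : exists e : R, a^T *m D *m a = e%:M by eexists; exact: mx11_scalar.
  by rewrite !mxE eqxx !mulr1n; ring.
have al0 : 0 < al.
  have := Spos (col_mx 1%:M 0).
  rewrite quadE trmx0 mulmx0 mul0mx mulmx0 !mxE mulr0 mul0r !addr0 expr1n mulr1.
  apply; apply/eqP => /(congr1 (fun A : 'cV_(1 + n) => A (lshift n 0) 0)).
  by rewrite col_mxEu !mxE eqxx => /eqP; rewrite oner_eq0.
have alN0 : al != 0 by rewrite gt_eqF.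
pose C := D - al^-1 *: (B^T *m B).
have [|K Ku KE] := IHn C.
  split; first by rewrite /C linearB/= linearZ/= trmx_mul trmxK Dsym.
  move=> a a0.
  (* This first coordinate minimizes the form of [S] for given [a]; the minimum is the form of the
     Schur complement. *)
  have := Spos (col_mx (- (B *m a) 0 0 / al)%:M a).
  rewrite quadE => h.
  rewrite /C mulmxBr mulmxBl -scalemxAr -scalemxAl.
  have -> : a^T *m (B^T *m B) *m a = (B *m a)^T *m (B *m a).
    by rewrite trmx_mul !mulmxA.
  have {}h : 0 < al * (- (B *m a) 0 0 / al) ^+ 2 +
      2 * (B *m a) 0 0 * (- (B *m a) 0 0 / al) + (a^T *m D *m a) 0 0.
    apply: h; apply: contra_neq a0 => /(congr1 dsubmx).
    by rewrite col_mxKd linear0.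
  move: h; have [b ->] : exists b : R, B *m a = b%:M by eexists; exact: mx11_scalar.
  have [e ->] : exists e : R, a^T *m D *m a = e%:M by eexists; exact: mx11_scalar.
  rewrite tr_scalar_mx mul_scalar_mx !mxE eqxx !mulr1n.
  by congr (_ < _); field.
have sa0 : Num.sqrt al != 0 by rewrite gt_eqF// sqrtr_gt0.
exists (block_mx (Num.sqrt al)%:M ((Num.sqrt al)^-1 *: B) 0 K).
  rewrite unitmxE det_ublock det_scalar1 unitrM unitfE sa0.
  by rewrite -unitmxE.
rewrite tr_block_mx mulmx_block {1}SE; congr (block_mx _ _ _ _).
- rewrite trmx0 mul0mx addr0 tr_scalar_mx -scalar_mxM.
  by rewrite -expr2 sqr_sqrtr// ltW.
- rewrite trmx0 mul0mx addr0 tr_scalar_mx -scalemxAr mul_scalar_mx scalerA.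
  by rewrite mulVf// scale1r.
- rewrite mulmx0 addr0 linearZ/= -scalemxAl mul_mx_scalar scalerA.
  by rewrite mulVf// scale1r.
- have -> : ((Num.sqrt al)^-1 *: B)^T = (Num.sqrt al)^-1 *: B^T by rewrite linearZ.
  rewrite -scalemxAl -scalemxAr scalerA -KE /C -invfM -expr2 sqr_sqrtr ?ltW//.
  by rewrite addrC subrK.
Qed.

Lemma det_spd_gt0 n (S : 'M[R]_n) : spd_mx S -> 0 < \det S.
Proof.
move=> /spd_mx_cholesky[K Ku ->]; rewrite det_mulmx det_tr -expr2.
by rewrite exprn_even_gt0//= -unitfE -unitmxE.
Qed.

Lemma spd_mxD n (S S' : 'M[R]_n) : spd_mx S -> spd_mx S' -> spd_mx (S + S').
Proof.
move=> [Ss Sp] [Ss' Sp']; split; first by rewrite linearD/= Ss Ss'.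
by move=> v v0; rewrite mulmxDr mulmxDl mxE addr_gt0 ?Sp ?Sp'.
Qed.

Lemma spd_mx1D n (D : 'M[R]_n) :
  D^T = D -> (forall v : 'cV[R]_n, 0 <= (v^T *m D *m v) 0 0) -> spd_mx (1%:M + D).
Proof.
move=> Ds D0; split; first by rewrite linearD/= trmx1 Ds.
move=> v v0; rewrite mulmxDr mulmxDl mulmx1 mxE ltr_pwDl// mxE.
have [i vi] : exists i, v i 0 != 0.
  apply/existsP; apply: contra_neqT v0 => /existsPn h.
  by apply/colP => i; rewrite mxE; apply/eqP; rewrite -[_ == _]negbK h.
rewrite (bigD1 i)//= ltr_pwDl//; first by rewrite mxE -expr2 exprn_even_gt0.
by apply: sumr_ge0 => j _; rewrite mxE -expr2 sqr_ge0.
Qed.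

Lemma det_1D_psd_gt0 n (D : 'M[R]_n) :
  D^T = D -> (forall v : 'cV[R]_n, 0 <= (v^T *m D *m v) 0 0) -> 0 < \det (1%:M + D).
Proof. by move=> Ds D0; exact: det_spd_gt0 (spd_mx1D Ds D0). Qed.

Lemma spd_mxZ n (S : 'M[R]_n) k : 0 < k -> spd_mx S -> spd_mx (k *: S).
Proof.
move=> k0 [Ss Sp]; split; first by rewrite linearZ/= Ss.
by move=> v v0; rewrite -scalemxAr -scalemxAl mxE mulr_gt0 ?Sp.
Qed.

Lemma spd_invmx_cholesky n (S : 'M[R]_n) : spd_mx S ->
  exists2 K : 'M[R]_n, K \in unitmx & invmx S = K^T *m K.
Proof.
move=> /spd_mx_cholesky[K Ku ->]; exists (invmx K)^T.
  by rewrite unitmx_tr unitmx_inv.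
have KTu : K^T \in unitmx by rewrite unitmx_tr.
have U : K^T *m K \in unitmx by rewrite unitmx_mul KTu.
apply: (can_inj (mulKmx U)); rewrite mulmxV// trmxK trmx_inv.
by rewrite mulmxA -(mulmxA K^T) mulmxV// mulmx1 mulmxV.
Qed.

Lemma inv_quadE n (S K : 'M[R]_n) (v : 'cV[R]_n) : invmx S = K^T *m K ->
  inv_quad S v = \sum_(i < n) ((K *m v) i 0) ^+ 2.
Proof.
move=> E; rewrite /inv_quad E mulmxA -trmx_mul -mulmxA mxE.
by apply: eq_bigr => i _; rewrite mxE expr2.
Qed.

(** Similarity is stated as an intertwining relation, so that it serves both for the given [M] and
    for factors exchanged around a product. *)
Lemma det_1D_conj n (A B Q : 'M[R]_n) (k : R) : Q \in unitmx ->
  Q *m A = B *m Q -> \det (1%:M + k *: A) = \det (1%:M + k *: B).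
Proof.
move=> Qu E; have dQ : \det Q != 0 by rewrite -unitfE -unitmxE.
apply: (mulfI dQ); rewrite -det_mulmx mulrC -det_mulmx.
by rewrite mulmxDr mulmxDl mulmx1 mul1mx -scalemxAr -scalemxAl E.
Qed.

End spd.

(** * Linear and quadratic forms in three independent Gaussian vectors *)

Definition iid2 d (E : measurableType d) (R : realType) (pi : probability E R) :
  probability (E * E)%type R := (pi \x pi)%E.

Definition iid3 d (E : measurableType d) (R : realType) (pi : probability E R) :
  probability (E * (E * E))%type R := (pi \x iid2 pi)%E.

Section gaussian_triple.
Variables (R : realType) (T : nat) (Sigma_u Sigma_x : 'M[R]_T).
Hypotheses (Sigma_u_spd : spd_mx Sigma_u) (Sigma_x_spd : spd_mx Sigma_x).
Variable piX : probability (T.-tuple R) R.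
Hypothesis piX_gaussian : multivariate_gaussian piX Sigma_x.

Local Notation E := (T.-tuple R).
Let dot (c : 'rV[R]_T) (x : E) : R := \sum_(i < T) c 0 i * tnth x i.
Let quad (c : 'rV[R]_T) : R := (c *m Sigma_x *m c^T) 0 0.

Lemma measurable_dot c : measurable_fun setT (dot c).
Proof.
by apply: measurable_sum => i; apply: measurable_funM => //; exact: measurable_tnth.
Qed.

(** The vectors are integrated out one at a time, the others entering as a phase. What remains is
    the cosine of (c0 + c1 + c2) applied to the common mean, hence cos 0. *)
Lemma has_mean_cos_triple (c0 c1 c2 : 'rV[R]_T) : c0 + c1 + c2 = 0 ->
  has_mean (iid3 piX)
    (fun z => cos (dot c0 z.1 + (dot c1 z.2.1 + dot c2 z.2.2)))
    (expR (- 2^-1 * (quad c0 + quad c1 + quad c2))).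
Proof.
move=> c012; case: piX_gaussian => gl gc.
have [m Hm] := gaussian_vector_cos (fun i => measurable_tnth i) gl gc.
have mcos : measurable_fun setT (@cos R).
  by apply: continuous_measurable_fun; exact: continuous_cos.
have bnd d0 (T0 : measurableType d0) (Q : probability T0 R) (f : T0 -> R) :
    measurable_fun setT f -> Q.-integrable setT (EFin \o (fun x => cos (f x))).
  move=> mf; have [r [] //] := @has_mean_bounded _ _ _ Q (fun x => cos (f x)) 1
    (measurableT_comp mcos mf) (fun x => cos_max _).
pose dm (c : 'rV[R]_T) : R := \sum_(i < T) c 0 i * m i.
have H2 b : has_mean (iid2 piX) (fun z => cos (dot c1 z.1 + (dot c2 z.2 + b)))
    (expR (- 2^-1 * quad c2) * (expR (- 2^-1 * quad c1) * cos (dm c1 + (dm c2 + b)))).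
  apply: (@has_mean_fubini1 _ _ _ _ _ _ _ _
      (fun x => expR (- 2^-1 * quad c2) * cos (dot c1 x + (dm c2 + b)))).
  - apply: bnd; apply: measurable_funD.
      exact: (measurableT_comp (measurable_dot _)).
    apply: measurable_funD => //.
    exact: (measurableT_comp (measurable_dot _)).
  - move=> x /=; have := Hm c2 (dot c1 x + b).
    rewrite [_ + (dm c2 + b)]addrCA; apply: eq_has_mean => y.
    by rewrite addrCA.
  - exact: has_meanZ (Hm c1 _).
have -> : expR (- 2^-1 * (quad c0 + quad c1 + quad c2)) =
  expR (- 2^-1 * quad c2) * (expR (- 2^-1 * quad c1) *
    (expR (- 2^-1 * quad c0) * cos (dm c0 + (dm c1 + dm c2)))).
  have -> : dm c0 + (dm c1 + dm c2) = 0.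
    rewrite /dm -!big_split/= big1// => i _; rewrite -!mulrDl addrA.
    by have /rowP/(_ i) := c012; rewrite !mxE => ->; rewrite mul0r.
  by rewrite cos0 mulr1 -!expRD; congr expR; ring.
apply: (@has_mean_fubini1 _ _ _ _ _ _ _ _
   (fun x => expR (- 2^-1 * quad c2) * (expR (- 2^-1 * quad c1) *
      cos (dot c0 x + (dm c1 + dm c2))))).
- apply: bnd; apply: measurable_funD.
    exact: (measurableT_comp (measurable_dot _)).
  apply: measurable_funD.
    apply: (measurableT_comp (measurable_dot _)).
    exact: (measurableT_comp measurable_fst).
  apply: (measurableT_comp (measurable_dot _)).
  exact: (measurableT_comp measurable_snd).
- move=> x /=; have := H2 (dot c0 x).
  rewrite [dot c0 x + _]addrC -addrA; apply: eq_has_mean => y.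
  by congr cos; ring.
- by apply: has_meanZ; apply: has_meanZ; exact: Hm.
Qed.

Definition triple_comb (a : 'rV[R]_3) (z : E * (E * E)) : 'cV[R]_T :=
  a 0 0 *: colvec z.1 + a 0 1 *: colvec z.2.1 + a 0 2 *: colvec z.2.2.

Let sum3 (f : 'I_3 -> R) : \sum_k f k = f 0 + f 1 + f 2.
Proof.
rewrite !big_ord_recl big_ord0 addr0 addrA.
by congr (_ + f _ + f _); exact: val_inj.
Qed.

Let dotE c x : dot c x = (c *m colvec x) 0 0.
Proof. by rewrite mxE; apply: eq_bigr => i _; rewrite mxE. Qed.

Let bil (v w : 'rV[R]_T) : R := (v *m Sigma_x *m w^T) 0 0.

Let bilC v w : bil v w = bil w v.
Proof.
rewrite /bil -[in LHS](trmxK (_ *m _ *m _)) mxE !trmx_mul trmxK mulmxA.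
by case: Sigma_x_spd => ->.
Qed.

Let quad_comb (p q : R) (v w : 'rV[R]_T) :
  quad (p *: v + q *: w) = p ^+ 2 * quad v + 2 * (p * q) * bil v w + q ^+ 2 * quad w.
Proof.
rewrite /quad linearD/= !mulmxDl !mulmxDr.
have -> : (p *: v)^T = p *: v^T by rewrite linearZ.
have -> : (q *: w)^T = q *: w^T by rewrite linearZ.
rewrite -!scalemxAl -!scalemxAr !scalerA ![(_ + _ : matrix _ _ _) 0 0]mxE.
rewrite ![(_ *: _ : matrix _ _ _) 0 0]mxE -/(bil v w) -/(bil w v) (bilC w v) /bil.
by ring.
Qed.

Let quad_ge0 v : 0 <= quad v.
Proof.
have [->|v0] := eqVneq v 0; first by rewrite /quad mul0mx mul0mx mxE.
case: Sigma_x_spd => _ /(_ v^T); rewrite trmxK => h; apply/ltW/h.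
by apply: contra_neq v0 => /(congr1 trmx); rewrite trmxK trmx0.
Qed.

(** Stacking [K] times the two combinations turns the exponent into minus half a squared norm. Zero
    sums make the stacked vector centred, and orthogonality of [a] and [b] removes the off-diagonal
    blocks of its covariance. *)
Lemma has_mean_inv_quad_triple (M : 'M[R]_T) (a b : 'rV[R]_3) :
  similar_in unitmx (invmx Sigma_u *m Sigma_x) M ->
  a 0 0 + a 0 1 + a 0 2 = 0 -> b 0 0 + b 0 1 + b 0 2 = 0 ->
  (a *m b^T) 0 0 = 0 ->
  has_mean (iid3 piX)
    (fun z => expR (- 2^-1 * (inv_quad Sigma_u (triple_comb a z)
                              + inv_quad Sigma_u (triple_comb b z))))
    (\det (1%:M + (a *m a^T) 0 0 *: M) `^ (- 2^-1) *
     \det (1%:M + (b *m b^T) 0 0 *: M) `^ (- 2^-1)).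
Proof.
move=> [Q Qu /eqP QM] a0 b0 ab0.
have [K Ku KE] := spd_invmx_cholesky Sigma_u_spd.
pose D := K *m Sigma_x *m K^T.
have quadK (c : 'rV[R]_T) : quad (c *m K) = (c *m D *m c^T) 0 0.
  by rewrite /quad /D trmx_mul !mulmxA.
have detE k : \det (1%:M + k *: D) = \det (1%:M + k *: M).
  have KTu : K^T \in unitmx by rewrite unitmx_tr.
  (* [K^T] intertwines the two matrices: K^T D = (K^T K) Sigma_x K^T. *)
  rewrite (@det_1D_conj _ _ D (invmx Sigma_u *m Sigma_x) _ k KTu); last first.
    by rewrite KE /D !mulmxA.
  apply: (@det_1D_conj _ _ _ _ _ _ Qu).
  by rewrite -QM /conjmx pinvmxE// mulmxKV// mulmxA.
set aa := (a *m a^T) 0 0; set bb := (b *m b^T) 0 0.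
have sq (c : 'rV[R]_3) : (c *m c^T) 0 0 = c 0 0 ^+ 2 + c 0 1 ^+ 2 + c 0 2 ^+ 2.
  by rewrite mxE sum3 !mxE !expr2.
pose C := block_mx (aa *: D) 0 0 (bb *: D) : 'M[R]_(T + T).
have Dsym : D^T = D.
  by rewrite /D !trmx_mul trmxK mulmxA; case: Sigma_x_spd => ->.
have Csym : C^T = C.
  rewrite /C tr_block_mx !trmx0; congr (block_mx _ _ _ _).
    by rewrite linearZ/= Dsym.
  by rewrite linearZ/= Dsym.
have quadC (c1 c2 : 'rV[R]_T) :
  ((row_mx c1 c2) *m C *m (row_mx c1 c2)^T) 0 0 =
    aa * quad (c1 *m K) + bb * quad (c2 *m K).
  rewrite /C tr_row_mx mul_row_block mul_row_col !mulmx0 add0r addr0 !quadK.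
  by rewrite -!scalemxAr -!scalemxAl mxE ![(_ *: _ : matrix _ _ _) 0 0]mxE.
have aa0 : 0 <= aa by rewrite /aa sq !addr_ge0// sqr_ge0.
have bb0 : 0 <= bb by rewrite /bb sq !addr_ge0// sqr_ge0.
have Cpsd (c : 'rV[R]_(T + T)) : 0 <= (c *m C *m c^T) 0 0.
  by rewrite -(hsubmxK c) quadC addr_ge0// mulr_ge0.
pose L (i : 'I_(T + T)) (z : E * (E * E)) : R :=
  (col_mx (K *m triple_comb a z) (K *m triple_comb b z)) i 0.
have mtnth1 i : measurable_fun setT (fun z : E * (E * E) => tnth z.1 i).
  exact: (measurableT_comp (measurable_tnth i)).
have mtnth2 i : measurable_fun setT (fun z : E * (E * E) => tnth z.2.1 i).
  apply: (measurableT_comp (measurable_tnth i)).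
  exact: (measurableT_comp measurable_fst).
have mtnth3 i : measurable_fun setT (fun z : E * (E * E) => tnth z.2.2 i).
  apply: (measurableT_comp (measurable_tnth i)).
  exact: (measurableT_comp measurable_snd).
have mcomb (c : 'rV[R]_3) j : measurable_fun setT (fun z => (K *m triple_comb c z) j 0).
  under eq_fun do rewrite mxE.
  apply: measurable_sum => i; apply: measurable_funM => //.
  under eq_fun do rewrite !mxE.
  apply: measurable_funD; last by apply: measurable_funM.
  by apply: measurable_funD; apply: measurable_funM.
have mL i : measurable_fun setT (L i).
  rewrite /L; case: (split_ordP i) => j ->.
    by under eq_fun do rewrite col_mxEu; exact: mcomb.
  by under eq_fun do rewrite col_mxEd; exact: mcomb.
have H (c : 'rV[R]_(T + T)) : has_mean (iid3 piX)
    (fun z => cst 1 z * cos (\sum_(i < T + T) c 0 i * L i z))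
    (1 * expR (- 2^-1 * (c *m C *m c^T) 0 0)).
  rewrite -(hsubmxK c); set c1 := lsubmx c; set c2 := rsubmx c.
  (* The coefficient of the k-th attribute in the projection of [L] along [c]. *)
  pose u k := a 0 k *: (c1 *m K) + b 0 k *: (c2 *m K).
  have u0 : u 0 + u 1 + u 2 = 0.
    apply/rowP => i; rewrite /u !mxE; move: (\sum_j _) (\sum_j _) => w v.
    transitivity ((a 0 0 + a 0 1 + a 0 2) * v + (b 0 0 + b 0 1 + b 0 2) * w).
      by ring.
    by rewrite a0 b0 !mul0r addr0.
  have := has_mean_cos_triple u0; rewrite mul1r quadC.
  have -> : quad (u 0) + quad (u 1) + quad (u 2) = aa * quad (c1 *m K) + bb * quad (c2 *m K).
    rewrite /u !quad_comb /aa /bb !sq.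
    (* The mixed terms of the three quadratic forms add up to a multiple of this inner product. *)
    have : a 0 0 * b 0 0 + a 0 1 * b 0 1 + a 0 2 * b 0 2 = 0.
      by rewrite -ab0 mxE sum3 !mxE.
    set v := quad _; set w := quad _; set x := bil _ _ => e.
    rewrite -[RHS]addr0 -[X in _ = _ + X](mulr0 (2 * x)) -e.
    by ring.
  apply: eq_has_mean => z; rewrite mul1r; congr cos.
  have -> : \sum_(i < T + T) (row_mx c1 c2) 0 i * L i z =
     (c1 *m K *m triple_comb a z) 0 0 + (c2 *m K *m triple_comb b z) 0 0.
    rewrite big_split_ord/= -!mulmxA [X in _ = X + _]mxE [X in _ = _ + X]mxE; congr (_ + _).
      by apply: eq_bigr => j _; rewrite row_mxEl /L col_mxEu.
    by apply: eq_bigr => j _; rewrite row_mxEr /L col_mxEd.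
  rewrite !dotE /u /triple_comb !mulmxDl !mulmxDr -!scalemxAl -!scalemxAr.
  rewrite ![(_ + _ : matrix _ _ _) 0 0]mxE ![(_ *: _ : matrix _ _ _) 0 0]mxE.
  by ring.
have g01 (z : E * (E * E)) : 0 <= (cst 1 z : R) <= 1 by rewrite /= ler01 lexx.
have mg : measurable_fun setT (cst 1 : E * (E * E) -> R) by exact: measurable_cst.
have [_] := gaussian_quadratic_form mL mg g01 Csym Cpsd H.
have -> : \det (1%:M + C) = \det (1%:M + aa *: D) * \det (1%:M + bb *: D).
  by rewrite scalar_mx_block add_block_mx !addr0 det_ublock.
have det0 k : 0 <= k -> 0 <= \det (1%:M + k *: D).
  move=> k0; apply/ltW/det_1D_psd_gt0; first by rewrite linearZ/= Dsym.
  move=> v; rewrite -scalemxAr -scalemxAl mxE mulr_ge0//.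
  by have := quad_ge0 (v^T *m K); rewrite quadK trmxK.
rewrite powRM ?det0// !detE mul1r; apply: eq_has_mean => z.
have -> : \sum_(i < T + T) L i z ^+ 2 =
    inv_quad Sigma_u (triple_comb a z) + inv_quad Sigma_u (triple_comb b z).
  rewrite big_split_ord/= !(inv_quadE _ KE); congr (_ + _); apply: eq_bigr => j _.
    by rewrite /L col_mxEu.
  by rewrite /L col_mxEd.
by rewrite /= mul1r.
Qed.

End gaussian_triple.

(** * Conditional expectation *)

Section set_integral.
Context d (T : measurableType d) (R : realType) (mu : {measure set T -> \bar R}).

Lemma integral_set_indic (A : set T) (f : T -> R) :
  (\int[mu]_(w in A) (f w)%:E = \int[mu]_w (f w * \1_A w)%:E)%E.
Proof.
rewrite integral_mkcond; apply: eq_integral => w _.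
by rewrite patchE indicE; case: ifP => _; rewrite ?mulr1 ?mulr0.
Qed.

Lemma has_mean_set_indic (A : set T) (f : T -> R) r : measurable A ->
  has_mean mu f r ->
  has_mean mu (fun w => f w * \1_A w) (fine (\int[mu]_(w in A) (f w)%:E)%E).
Proof.
move=> mA hf; have mf := has_mean_measurable hf; case: hf => If _.
have I : mu.-integrable setT (EFin \o (fun w => f w * \1_A w)).
  apply: (le_integrable _ _ _ If) => //.
    by apply/measurable_EFinP; exact: measurable_funM.
  move=> w _; rewrite /= lee_fin normrM indicE.
  by case: (w \in A); rewrite ?normr1 ?normr0 ?mulr1 ?mulr0.
split => //; rewrite [in RHS]integral_set_indic fineK//.
exact: integrable_fin_num I.
Qed.

Lemma has_mean_ae0 (f : T -> R) : measurable_fun setT f ->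
  {ae mu, forall w, f w = 0} -> has_mean mu f 0.
Proof.
move=> mf f0; have mF : measurable_fun setT (EFin \o f) by exact/measurable_EFinP.
have ae0 : ae_eq mu setT (EFin \o f) (cst 0%E).
  by apply: filterS f0 => w /= -> _.
split.
  apply/integrableP; split => //.
  by move/(ae_eq_integral_abs mu measurableT mF) : ae0 => ->; rewrite ltry.
transitivity (\int[mu]_x (cst 0%E : T -> \bar R) x)%E; last by rewrite integral0.
exact: ae_eq_integral.
Qed.

End set_integral.

Section sub_sigma_algebra.
Context d (Omega : measurableType d) (R : realType) (P : probability Omega R).
Variable G : set (set Omega).
Implicit Types (GS : <<s G >> `<=` measurable) (Z V : Omega -> R).

(** The identity read as a map to the coarser sigma-algebra: the restriction of [P] is its image
    law, so the transport rules for image measures apply. *)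
Definition to_sub GS : Omega -> g_sigma_algebraType G := id.

Lemma measurable_to_sub GS : measurable_fun setT (to_sub GS).
Proof. by move=> _ B mB; rewrite setTI; exact (GS _ mB). Qed.

HB.instance Definition _ GS := isMeasurableFun.Build _ _ _ _ (to_sub GS) (measurable_to_sub GS).

Definition sub_probability GS : probability (g_sigma_algebraType G) R :=
  distribution P (to_sub GS).

Lemma has_mean_sub GS (V : g_sigma_algebraType G -> R) r :
  has_mean (sub_probability GS) V r -> has_mean P V r.
Proof.
move=> h; apply: (@has_mean_pushforward _ _ _ _ _ P (to_sub GS) (sub_probability GS)) => //.
Qed.

Definition sub_charge GS (f : Omega -> \bar R) (intf : P.-integrable setT f)
  (A : set (g_sigma_algebraType G)) : \bar R := induced_charge intf (A : set Omega).

Section sub_charge.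
Variables (GS : <<s G >> `<=` measurable) (f : Omega -> \bar R).
Hypothesis intf : P.-integrable setT f.

Let sub_charge0 : sub_charge GS intf set0 = 0%E.
Proof. by rewrite /sub_charge charge0. Qed.

Let sub_charge_fin A : measurable A -> sub_charge GS intf A \is a fin_num.
Proof. by move=> mA; rewrite /sub_charge fin_num_measure//; exact (@GS _ mA). Qed.

Let sub_charge_sigma : semi_sigma_additive (sub_charge GS intf).
Proof.
move=> F mF tF mUF; apply: (@charge_semi_sigma_additive _ _ _ (induced_charge intf)) => //.
- by move=> i; exact (@GS _ (mF i)).
- exact (@GS _ mUF).
Qed.

HB.instance Definition _ := isCharge.Build _ _ _ (sub_charge GS intf)
  sub_charge0 sub_charge_fin sub_charge_sigma.

Lemma sub_charge_dominates : sub_charge GS intf `<< sub_probability GS.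
Proof.
apply/null_content_dominatesP => A mA A0.
apply: null_set_integral; first exact (@GS _ mA).
  by apply: measurable_funTS; exact: measurable_int intf.
exact: A0.
Qed.

End sub_charge.

(** The version is the Radon-Nikodym derivative, on the sub-sigma-algebra, of the charge that
    integrates [Z] over an event. *)
Lemma is_condexp_exists GS Z : P.-integrable setT (EFin \o Z) ->
  exists V, is_condexp P G Z V.
Proof.
move=> intZ; pose nu := sub_charge GS intZ.
have dom : nu `<< sub_probability GS by exact: sub_charge_dominates.
pose V : g_sigma_algebraType G -> R := fine \o Radon_Nikodym nu (sub_probability GS).
have RNE w : Radon_Nikodym nu (sub_probability GS) w = (V w)%:E.
  by rewrite /V /= fineK//; exact: Radon_Nikodym_fin_num.
have IV : (sub_probability GS).-integrable setT (EFin \o V).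
  have -> : EFin \o V = Radon_Nikodym nu (sub_probability GS).
    by apply/funext => w; rewrite RNE.
  exact: Radon_Nikodym_integrable.
have mV : measurable_fun setT V by apply/measurable_EFinP; exact: measurable_int IV.
have hV : has_mean (sub_probability GS) V (fine (\int[sub_probability GS]_w (V w)%:E)%E).
  by split => //; rewrite fineK//; exact: integrable_fin_num IV.
exists V; split => //; first by have [] := has_mean_sub hV.
move=> A GA.
have mGA : measurable (A : set (g_sigma_algebraType G)) by exact: GA.
have RNA : (\int[P]_(w in A) (Z w)%:E =
   \int[sub_probability GS]_(x in A) Radon_Nikodym nu (sub_probability GS) x)%E.
  exact: Radon_Nikodym_integral dom mGA.
rewrite RNA.
have -> : (\int[sub_probability GS]_(x in A) Radon_Nikodym nu (sub_probability GS) x =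
   \int[sub_probability GS]_(x in A) (V x)%:E)%E.
  by apply: eq_integral => w _; rewrite RNE.
have hA := has_mean_set_indic mGA hV.
rewrite integral_set_indic (has_mean_sub hA).2.
by rewrite [RHS]integral_set_indic hA.2.
Qed.

Lemma condexpP GS Z V : is_condexp P G Z V -> is_condexp P G Z (condexp P G Z).
Proof. by move=> H; exact: (xgetPex _ (ex_intro _ V H)). Qed.

Lemma is_condexp_measurable GS Z V : is_condexp P G Z V -> measurable_fun setT V.
Proof.
move=> [mV _ _] _ B mB; rewrite setTI; apply: GS.
by have := mV measurableT B mB; rewrite setTI.
Qed.

(** The event A = {V >= 0} belongs to the sub-sigma-algebra, and |V| = 2 V 1_A - V, so the integral
    of |V| vanishes. *)
Lemma is_condexp_ae0 GS Z V : is_condexp P G Z (cst 0) -> is_condexp P G Z V ->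
  {ae P, forall w, V w = 0}.
Proof.
move=> [_ _ Z0] HV; have mV := is_condexp_measurable GS HV; case: HV => mGV IV VZ.
have V0 A : <<s G >> A -> (\int[P]_(w in A) (V w)%:E = 0)%E.
  by move=> GA; rewrite VZ// -Z0// integral0.
pose A : set Omega := [set w | 0 <= V w].
have GA : <<s G >> A.
  have := mGV measurableT `[0, +oo[%classic (measurable_itv _).
  by rewrite setTI; congr (<<s G >> _); apply/seteqP; split => w; rewrite /= in_itv/= andbT.
have mF : measurable_fun setT (EFin \o V) by exact/measurable_EFinP.
have : ae_eq P setT (EFin \o V) (cst 0%E).
  apply/(ae_eq_integral_abs P measurableT mF).
  have hV : has_mean P V 0.
    by split => //; apply: V0; exact: (@measurableT _ (g_sigma_algebraType G)).
  have := has_mean_set_indic (GS _ GA) hV; rewrite V0//= => hA.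
  have [_] := has_meanB (has_meanZ 2 hA) hV.
  rewrite mulr0 subr0 => E.
  transitivity (\int[P]_w (((fun w => 2 * (V w * \1_A w)) \- V) w)%:E)%E; last exact: E.
  apply: eq_integral => w _ /=; congr EFin.
  rewrite indicE; have [wA|wA] := boolP (w \in A).
    by move: wA; rewrite inE /A /= => w0; rewrite ger0_norm//; ring.
  move: wA; rewrite notin_setE /A /= => /negP; rewrite -ltNge => w0.
  by rewrite ltr0_norm//; ring.
by apply: filterS => w /(_ I) /= [].
Qed.

(** The chosen conditional means vanish almost everywhere, so the centred product is almost
    everywhere Z1 Z2; the outer conditional expectation is removed by testing it on the whole
    space. *)
Lemma expectation_condcov GS Z1 Z2 r :
  measurable_fun setT Z1 -> measurable_fun setT Z2 ->
  is_condexp P G Z1 (cst 0) -> is_condexp P G Z2 (cst 0) ->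
  has_mean P (fun w => Z1 w * Z2 w) r ->
  fine 'E_P[condcov P G Z1 Z2]%E = r.
Proof.
move=> mZ1 mZ2 H1 H2 h.
set V1 := condexp P G Z1; set V2 := condexp P G Z2.
have C1 : is_condexp P G Z1 V1 := condexpP GS H1.
have C2 : is_condexp P G Z2 V2 := condexpP GS H2.
have mV1 := is_condexp_measurable GS C1; have mV2 := is_condexp_measurable GS C2.
have hQ : has_mean P (fun w => (Z1 w - V1 w) * (Z2 w - V2 w)) r.
  have h0 : has_mean P (fun w => (Z1 w - V1 w) * (Z2 w - V2 w) - Z1 w * Z2 w) 0.
    apply: has_mean_ae0.
      apply: measurable_funB; last exact: measurable_funM.
      by apply: measurable_funM; exact: measurable_funB.
    apply: filterS2 (is_condexp_ae0 GS H1 C1) (is_condexp_ae0 GS H2 C2) => w -> ->.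
    by rewrite !subr0 subrr.
  have := has_meanD h0 h; rewrite add0r; apply: eq_has_mean => w /=.
  by rewrite subrK.
have [V HV] := is_condexp_exists GS hQ.1.
have [_ IV VQ] := condexpP GS HV.
rewrite unlock /condcov -/V1 -/V2 VQ; last exact: (@measurableT _ (g_sigma_algebraType G)).
by rewrite hQ.2.
Qed.

End sub_sigma_algebra.

(** * Independence and product laws *)

Section joint_law.
Context d1 d2 (T1 : measurableType d1) (T2 : measurableType d2) (R : realType).

Lemma measure_prod_unique (m m' : {measure set (T1 * T2) -> \bar R}) :
  (m setT < +oo)%E ->
  (forall A B, measurable A -> measurable B -> m (A `*` B) = m' (A `*` B)) ->
  forall D, measurable D -> m D = m' D.
Proof.
move=> mfin mm' D mD.
pose C : set (set (T1 * T2)) :=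
  [set C | exists A, measurable A /\ exists B, measurable B /\ C = A `*` B].
apply: (measure_unique C (fun=> setT)) => //.
- rewrite measurable_prod_measurableType //; congr (<<s _ >>).
  rewrite predeqE; split => [[A mA [B mB <-]]|[A [mA [B [mB ->]]]]].
    by exists A; split => //; exists B.
  by exists A => //; exists B.
- move=> /= _ _ [X1 [mX1 [X2 [mX2 ->]]]] [Y1 [mY1 [Y2 [mY2 ->]]]].
  rewrite -setXI; exists (X1 `&` Y1); split; first exact: measurableI.
  by exists (X2 `&` Y2); split => //; exact: measurableI.
- by move=> n; exists setT; split => //; exists setT; split => //; rewrite setXTT.
- by rewrite bigcup_const//; exists 0%N.
- by move=> A [A1 [mA1 [A2 [mA2 ->]]]]; exact: mm'.
Qed.

Context d (Omega : measurableType d) (P : probability Omega R).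

(** Both sides are finite measures in [D] that agree on rectangles. Carrying the event [C] allows
    product laws to be built up one coordinate at a time. *)
Lemma indep_pair_law (C : set Omega) (f1 : Omega -> T1) (f2 : Omega -> T2)
    (m1 : probability T1 R) (m2 : probability T2 R) :
  measurable C -> measurable_fun setT f1 -> measurable_fun setT f2 ->
  (forall A B, measurable A -> measurable B ->
    P (C `&` (f1 @^-1` A `&` f2 @^-1` B)) = (P C * (m1 A * m2 B))%E) ->
  forall D, measurable D ->
    P (C `&` (fun w => (f1 w, f2 w)) @^-1` D) = (P C * (m1 \x m2) D)%E.
Proof.
move=> mC mf1 mf2 H D mD.
pose f w := (f1 w, f2 w).
have mf : measurable_fun setT f by exact/measurable_fun_pairP.
pose f' : {mfun Omega >-> (T1 * T2)%type} :=
  MeasurableFun.Pack (MeasurableFun.Class (isMeasurableFun.Build _ _ _ _ _ mf)).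
have PC0 : 0 <= fine (P C) by rewrite fine_ge0.
have PCE : (fine (P C))%:E = P C by rewrite fineK// fin_num_measure.
have E : forall D, measurable D ->
    pushforward (mrestr P mC) f' D = mscale (NngNum PC0) (m1 \x m2)%E D.
  apply: measure_prod_unique => //.
    change (P (setT `&` C) < +oo)%E.
    by rewrite setTI ltey_eq fin_num_measure.
  move=> A B mA mB.
  transitivity ((fine (P C))%:E * (m1 \x m2)%E (A `*` B))%E => //.
  by rewrite PCE product_measure1E// -H// setIC.
by rewrite setIC -PCE; exact: E.
Qed.

End joint_law.

(** * Random functions *)

Section random_function.
Context d d' (Omega : measurableType d) (E : measurableType d') (R : realType).
Variables (P : probability Omega R) (F : E -> E -> Omega -> R).
Local Notation G := (random_function_events F).

Lemma random_function_events_measurable :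
  (forall x y, measurable_fun setT (F x y)) -> <<s G >> `<=` measurable.
Proof.
move=> mF; apply: smallest_sub; first exact: sigma_algebra_measurable.
move=> _ [x [y [B mB ->]]]; rewrite -[_ @^-1` _]setTI; exact: mF.
Qed.

Lemma random_function_events_fun x y :
  measurable_fun [set: g_sigma_algebraType G] (F x y).
Proof.
by move=> _ B mB; rewrite setTI; apply: sub_gen_smallest; exists x, y, B.
Qed.

Hypothesis GS : <<s G >> `<=` measurable.

Lemma has_mean_subP (V : Omega -> R) r :
  measurable_fun [set: g_sigma_algebraType G] V ->
  has_mean P V r -> has_mean (sub_probability P GS) V r.
Proof.
move=> mV [IV EV].
have mV' : measurable_fun [set: g_sigma_algebraType G] (EFin \o V) by exact/measurable_EFinP.
have ms := measurable_to_sub GS.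
split; first exact: (@integrable_pushforward _ _ _ _ _ _ ms P setT _ mV' IV measurableT).
by rewrite -EV; exact: (@integral_pushforward _ _ _ _ _ _ ms P setT _ mV' IV measurableT).
Qed.

Variable pi : probability E R.

(** Independence and the common law in one identity; with [pi] in place of the individual laws it is
    invariant under permuting the three variables. *)
Definition indep_iid3 (X1 X2 X3 : Omega -> E) : Prop :=
  forall A B1 B2 B3, <<s G >> A -> measurable B1 -> measurable B2 -> measurable B3 ->
    P (A `&` (X1 @^-1` B1 `&` (X2 @^-1` B2 `&` X3 @^-1` B3))) =
    (P A * (pi B1 * (pi B2 * pi B3)))%E.

Lemma indep_iid3_swap12 X1 X2 X3 : indep_iid3 X1 X2 X3 -> indep_iid3 X2 X1 X3.
Proof.
move=> H A B1 B2 B3 GA m1 m2 m3.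
by rewrite [X in _ `&` X]setICA H//; congr (_ * _)%E; exact: muleCA.
Qed.

Lemma indep_iid3_swap23 X1 X2 X3 : indep_iid3 X1 X2 X3 -> indep_iid3 X1 X3 X2.
Proof.
move=> H A B1 B2 B3 GA m1 m2 m3.
by rewrite [X3 @^-1` _ `&` _]setIC H// [(pi B2 * _)%E]muleC.
Qed.

(** [indep_pair_law] is applied three times: to (X2, X3), then to X1 with that pair, then to the
    identity into the sigma-algebra of [F] with the triple. The joint law is thus a product, and the
    mean is transported from it. *)
Lemma has_mean_joint (X1 X2 X3 : Omega -> E)
    (f : g_sigma_algebraType G * (E * (E * E)) -> R) r :
  measurable_fun setT X1 -> measurable_fun setT X2 -> measurable_fun setT X3 ->
  indep_iid3 X1 X2 X3 ->
  has_mean (sub_probability P GS \x iid3 pi)%E f r ->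
  has_mean P (fun w => f (w, (X1 w, (X2 w, X3 w)))) r.
Proof.
move=> m1 m2 m3 H.
have m23 : measurable_fun setT (fun w => (X2 w, X3 w)) by exact: measurable_fun_pair.
have m123 : measurable_fun setT (fun w => (X1 w, (X2 w, X3 w))) by exact: measurable_fun_pair.
have mpre d0 (T0 : measurableType d0) (Z : Omega -> T0) B :
    measurable_fun setT Z -> measurable B -> measurable (Z @^-1` B).
  by move=> mZ mB; rewrite -[_ @^-1` _]setTI; exact: mZ.
have H1 A B1 D : <<s G >> A -> measurable B1 -> measurable D ->
    P (A `&` (X1 @^-1` B1 `&` (fun w => (X2 w, X3 w)) @^-1` D)) =
    (P A * (pi B1 * iid2 pi D))%E.
  move=> GA mB1 mD; rewrite setIA.
  rewrite (@indep_pair_law _ _ _ _ _ _ _ P (A `&` X1 @^-1` B1) X2 X3 pi pi)//.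
  - rewrite muleA; congr (_ * _)%E.
    have := H A B1 setT setT GA mB1 measurableT measurableT.
    by rewrite !preimage_setT !setIT !probability_setT !mule1.
  - apply: measurableI; first exact (@GS _ GA).
    exact: mpre.
  - move=> B2 B3 mB2 mB3; rewrite -setIA H// muleA; congr (_ * _)%E.
    have := H A B1 setT setT GA mB1 measurableT measurableT.
    by rewrite !preimage_setT !setIT !probability_setT !mule1.
have H2 A D : <<s G >> A -> measurable D ->
    P (A `&` (fun w => (X1 w, (X2 w, X3 w))) @^-1` D) = (P A * iid3 pi D)%E.
  move=> GA mD.
  rewrite (@indep_pair_law _ _ _ _ _ _ _ P A X1 _ pi (iid2 pi))//.
  - exact (@GS _ GA).
  - by move=> B1 B2 mB1 mB2; exact: H1.
apply: (@has_mean_pushforward _ _ _ _ _ P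
  (fun w => (to_sub GS w, (X1 w, (X2 w, X3 w))))).
  by apply: measurable_fun_pair => //; exact: measurable_to_sub.
move=> D mD; rewrite -[LHS]mul1e -(probability_setT P).
rewrite -[X in (_ * P X)%E]setTI.
rewrite (@indep_pair_law _ _ _ _ _ _ _ P setT (to_sub GS) _ (sub_probability P GS) (iid3 pi))//.
- by rewrite probability_setT !mul1e.
- by move=> A B mA mB; rewrite setTI H2// probability_setT mul1e.
Qed.

End random_function.

(** * The correlation of a skew random function from its second moments *)

Section shared_endpoint.
Context d d' (Omega : measurableType d) (E : measurableType d') (R : realType).
Variables (P : probability Omega R) (F : E -> E -> Omega -> R).
Local Notation G := (random_function_events F).
Hypothesis GS : <<s G >> `<=` measurable.
Hypothesis F_measurable : measurable_random_function F.
Hypothesis F_skew : forall x y w, F y x w = - F x y w.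
Variables (pi : probability E R) (s : E -> E -> R).
Hypothesis F_sqr : forall x y, has_mean P (fun w => F x y w ^+ 2) (s x y).
Variables S S' : R.
Hypothesis s_mean : has_mean (iid3 pi) (fun z => s z.1 z.2.1) S.
Hypothesis s_mean' : has_mean (iid3 pi) (fun z => s z.1 z.2.2) S'.

Local Notation J := (sub_probability P GS \x iid3 pi)%E.
Local Notation TJ := (g_sigma_algebraType G * (E * (E * E)))%type.

Let Fm : measurable_fun [set: (g_sigma_algebraType G * (E * E))%type]
    (fun q => F q.2.1 q.2.2 q.1) := F_measurable.

Let mF1 : measurable_fun [set: TJ] (fun q => F q.2.1 q.2.2.1 q.1).
Proof.
apply: (measurableT_comp Fm (g := fun q : TJ => (q.1, (q.2.1, q.2.2.1)))).
apply: measurable_fun_pair => //; apply: measurable_fun_pair.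
  exact: (measurableT_comp measurable_fst).
apply: (measurableT_comp measurable_fst).
exact: (measurableT_comp measurable_snd).
Qed.

Let mF2 : measurable_fun [set: TJ] (fun q => F q.2.1 q.2.2.2 q.1).
Proof.
apply: (measurableT_comp Fm (g := fun q : TJ => (q.1, (q.2.1, q.2.2.2)))).
apply: measurable_fun_pair => //; apply: measurable_fun_pair.
  exact: (measurableT_comp measurable_fst).
apply: (measurableT_comp measurable_snd).
exact: (measurableT_comp measurable_snd).
Qed.

Let F_sqr_sub x y : has_mean (sub_probability P GS) (fun w => F x y w ^+ 2) (s x y).
Proof.
apply: has_mean_subP (F_sqr x y).
by apply: measurable_funX; exact: random_function_events_fun.
Qed.

Let F1_sqr : has_mean J (fun q : TJ => F q.2.1 q.2.2.1 q.1 ^+ 2) S.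
Proof.
apply: (has_mean_tonelli2 _ _ _ s_mean).
- exact: measurable_funX.
- by move=> q; exact: sqr_ge0.
- by move=> z /=; exact: F_sqr_sub.
Qed.

Let F2_sqr : has_mean J (fun q : TJ => F q.2.1 q.2.2.2 q.1 ^+ 2) S'.
Proof.
apply: (has_mean_tonelli2 _ _ _ s_mean').
- exact: measurable_funX.
- by move=> q; exact: sqr_ge0.
- by move=> z /=; exact: F_sqr_sub.
Qed.

Let le_sqr (x : R) : `|x| <= 1 + x ^+ 2.
Proof.
have := sqr_ge0 (`|x| - 1); rewrite sqrrB1 real_normK ?num_real//.
by have := normr_ge0 x; lra.
Qed.

Let integrable_of_sqr (f g : TJ -> R) r : measurable_fun setT f ->
  measurable_fun setT g -> (forall q, `|g q| <= 1) ->
  has_mean J (fun q => f q ^+ 2) r -> exists r', has_mean J (fun q => f q * g q) r'.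
Proof.
move=> mf mg g1 hf.
have [I _] := has_meanD (has_mean_cst J 1) hf.
have I' : J.-integrable setT (EFin \o (fun q => f q * g q)).
  apply: (le_integrable _ _ _ I) => //.
    by apply/measurable_EFinP; exact: measurable_funM.
  move=> q _; rewrite /= lee_fin normrM [leRHS]ger0_norm ?addr_ge0 ?sqr_ge0//.
  by apply: le_trans (le_sqr _); rewrite ler_piMr.
exists (fine (\int[J]_q (f q * g q)%:E)%E); split => //.
by rewrite fineK//; exact: integrable_fin_num I'.
Qed.

Variables X Y W : Omega -> E.
Hypotheses (mX : measurable_fun setT X) (mY : measurable_fun setT Y)
  (mW : measurable_fun setT W) (XYW : indep_iid3 P F pi X Y W).

(* Exchanging the two endpoints preserves the joint law with [F] but changes the
   sign of [F], so the conditional mean vanishes. *)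
Let condexp0 (X1 X2 X3 : Omega -> E) :
  measurable_fun setT X1 -> measurable_fun setT X2 -> measurable_fun setT X3 ->
  indep_iid3 P F pi X1 X2 X3 ->
  measurable_fun setT (fun w => F (X1 w) (X2 w) w) /\
  is_condexp P G (fun w => F (X1 w) (X2 w) w) (cst 0).
Proof.
move=> m1 m2 m3 H.
have [r0 hr0] : exists r', has_mean J (fun q : TJ => F q.2.1 q.2.2.1 q.1 * cst 1 q) r'.
  by apply: (integrable_of_sqr (g := cst 1) mF1 _ _ F1_sqr) => // q; rewrite normr1.
split.
  have := has_mean_measurable (has_mean_joint m1 m2 m3 H hr0).
  by congr measurable_fun; apply/funext => w; rewrite /= mulr1.
split.
- exact: measurable_cst.
- exact: (has_mean_cst P 0).1.
- move=> A GA; rewrite integral0 integral_set_indic.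
  have mA : measurable_fun [set: TJ] (fun q => \1_(A : set (g_sigma_algebraType G)) q.1 : R).
    apply: (measurableT_comp (f := fun x => \1_(A : set (g_sigma_algebraType G)) x : R)) => //.
    exact: measurable_indic.
  have [r hr] : exists r', has_mean J (fun q : TJ => F q.2.1 q.2.2.1 q.1 * \1_A q.1) r'.
    apply: (integrable_of_sqr mF1 mA _ F1_sqr) => q.
    by rewrite indicE; case: (_ \in _); rewrite ?normr1 ?normr0.
  have e1 := has_mean_joint m1 m2 m3 H hr.
  have e2 := has_mean_joint m2 m1 m3 (indep_iid3_swap12 H) hr.
  have e3 : has_mean P (fun w => F (X1 w) (X2 w) w * \1_A w) (- r).
    have := has_meanZ (-1) e2; rewrite mulN1r; apply: eq_has_mean => w /=.
    by rewrite F_skew mulN1r mulNr opprK.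
  have r0E : r = 0 by have := has_mean_uniq e1 e3; lra.
  by rewrite r0E in e1; rewrite e1.2.
Qed.

Variables (c : E * (E * E) -> R) (C : R).
Hypothesis F_cross :
  forall x y w, has_mean P (fun v => F x y v * F x w v) (c (x, (y, w))).
Hypothesis c_mean : has_mean (iid3 pi) c C.

Lemma shared_endpoint_correlationE :
  shared_endpoint_correlation P F X Y W = S^-1 * C.
Proof.
have [mZ1 C1] := condexp0 mX mY mW XYW.
have [mZ2 C2] := condexp0 mX mW mY (indep_iid3_swap23 XYW).
rewrite /shared_endpoint_correlation /variance_F /condvar.
congr (_^-1 * _).
- apply: (expectation_condcov GS) => //.
  by apply: eq_has_mean (has_mean_joint mX mY mW XYW F1_sqr) => w; rewrite expr2.
- apply: (expectation_condcov GS) => //.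
  (* The product changes sign, so its integrability on the joint space comes from the two squares
     before Fubini is applied. *)
  have [r [I12 _]] := has_mean_sqr_mul mF1 mF2 F1_sqr F2_sqr.
  apply: (has_mean_joint mX mY mW XYW (f := fun q => F q.2.1 q.2.2.1 q.1 * F q.2.1 q.2.2.2 q.1)).
  apply: (has_mean_fubini2 I12 _ c_mean) => -[x [y w]] /=.
  apply: has_mean_subP (F_cross x y w).
  by apply: measurable_funM; exact: random_function_events_fun.
Qed.

End shared_endpoint.

(** * The squared exponential kernel *)

Section similar_det.
Variables (R : realType) (T : nat) (Sigma_u Sigma_x M : 'M[R]_T).
Hypotheses (Sigma_u_spd : spd_mx Sigma_u) (Sigma_x_spd : spd_mx Sigma_x).
Hypothesis M_similar : similar_in unitmx (invmx Sigma_u *m Sigma_x) M.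

(** Up to similarity the matrix is Sigma_u^-1 (Sigma_u + k Sigma_x), a product of two matrices with
    positive determinant. *)
Lemma det_1D_similar_gt0 k : 0 <= k -> 0 < \det (1%:M + k *: M).
Proof.
move=> k0; case: M_similar => Q Qu /eqP QM.
have u0 := det_spd_gt0 Sigma_u_spd.
have uU : Sigma_u \in unitmx by rewrite unitmxE unitfE gt_eqF.
rewrite -(@det_1D_conj _ _ (invmx Sigma_u *m Sigma_x) M Q k Qu); last first.
  by rewrite -QM /conjmx pinvmxE// mulmxKV// mulmxA.
have -> : 1%:M + k *: (invmx Sigma_u *m Sigma_x) = invmx Sigma_u *m (Sigma_u + k *: Sigma_x).
  by rewrite mulmxDr mulVmx// scalemxAr.
rewrite det_mulmx mulr_gt0//; first by rewrite det_inv invr_gt0.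
move: k0; rewrite le_eqVlt => /predU1P[<-|k0]; first by rewrite scale0r addr0.
exact/det_spd_gt0/(spd_mxD Sigma_u_spd)/(spd_mxZ k0).
Qed.

Variable lambda : 'I_T -> R.
Hypothesis M_char : char_poly M = \prod_(j < T) ('X - (lambda j)%:P).

(** For k != 0 the determinant is (- k)^T times the characteristic polynomial at - 1 / k. *)
Lemma det_1D_char_poly k : \det (1%:M + k *: M) = \prod_(j < T) (1 + k * lambda j).
Proof.
have [->|k0] := eqVneq k 0.
  by rewrite scale0r addr0 det1 big1// => j _; rewrite mul0r addr0.
have -> : 1%:M + k *: M = (- k) *: ((- k^-1)%:M - M).
  by rewrite scalerBr scale_scalar_mx mulrNN mulfV// scaleNr opprK.
rewrite detZ.
have -> : \det ((- k^-1)%:M - M) = (char_poly M).[- k^-1].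
  rewrite /char_poly -horner_evalE -det_map_mx; congr (\det _).
  apply/matrixP => i j; rewrite !mxE /= /horner_eval.
  by rewrite hornerD hornerN hornerMn hornerX hornerC.
rewrite M_char horner_prod -[X in _ ^+ X]card_ord -prodr_const -big_split/=.
by apply: eq_bigr => j _; rewrite !hornerE; field.
Qed.

(** A negative eigenvalue would make det(1 + k M) vanish at the positive number k = - 1 /
    lambda_j. *)
Lemma similar_eigenvalue_ge0 j : 0 <= lambda j.
Proof.
rewrite leNgt; apply/negP => lj0.
have := det_1D_similar_gt0 (k := - (lambda j)^-1).
rewrite oppr_ge0 invr_le0 (ltW lj0) => /(_ isT).
by rewrite det_1D_char_poly (bigD1 j)//= mulNr mulVf ?lt_eqF// subrr mul0r ltxx.
Qed.

Lemma powR_prod I (r : seq I) (f : I -> R) (a : R) : (forall i, 0 <= f i) ->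
  (\prod_(i <- r) f i) `^ a = \prod_(i <- r) f i `^ a.
Proof.
move=> f0; elim: r => [|i r IH]; first by rewrite !big_nil powR1.
by rewrite !big_cons powRM// ?IH// prodr_ge0.
Qed.

Lemma powR_det_1D k (r : 'I_T -> R) a : 0 <= k ->
  (forall j, r j = Num.sqrt (lambda j)) ->
  (\det (1%:M + k *: M)) `^ a = \prod_(j < T) (1 + k * r j ^+ 2) `^ a.
Proof.
move=> k0 rE; rewrite det_1D_char_poly.
rewrite powR_prod => [|j]; last by rewrite addr_ge0// mulr_ge0// similar_eigenvalue_ge0.
by apply: eq_bigr => j _; rewrite rE sqr_sqrtr// similar_eigenvalue_ge0.
Qed.

End similar_det.

Section inv_quad.
Variables (R : realType) (T : nat) (S : 'M[R]_T).
Hypothesis S_spd : spd_mx S.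
Implicit Types u v : 'cV[R]_T.

Lemma inv_quadZ k v : inv_quad S (k *: v) = k ^+ 2 * inv_quad S v.
Proof.
have vZ : (k *: v)^T = k *: v^T by rewrite linearZ.
by rewrite /inv_quad vZ -scalemxAr -!scalemxAl scalerA mxE expr2.
Qed.

Lemma inv_quad0 : inv_quad S 0 = 0.
Proof. by rewrite /inv_quad mulmx0 mxE. Qed.

Lemma inv_quadN v : inv_quad S (- v) = inv_quad S v.
Proof. by rewrite -scaleN1r inv_quadZ sqrrN expr1n mul1r. Qed.

Lemma inv_quad_parallelogram u v :
  inv_quad S (u - v) + inv_quad S (u + v) = 2 * (inv_quad S u + inv_quad S v).
Proof.
have [K _ KE] := spd_invmx_cholesky S_spd.
rewrite !(inv_quadE _ KE) -!big_split/= mulr_sumr; apply: eq_bigr => i _.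
by rewrite mulmxBr mulmxDr !mxE; ring.
Qed.

End inv_quad.

Section skew_gaussian_process.
Context (R : realType) (T : nat) (Sigma_u : 'M[R]_T) (sigma_u : R).
Context (d : measure_display) (Omega : measurableType d) (P : probability Omega R).
Local Notation E := (T.-tuple R).
Variable U : E * E -> {RV P >-> R}.
Hypothesis U_gaussian : gaussian_process P (fun p => U p : Omega -> R).
Hypothesis U_covariance : forall p q : E * E,
  covariance P (U p) (U q) = (se_kernel sigma_u Sigma_u p q)%:E.
Variable F : E -> E -> Omega -> R.
Hypothesis F_def : forall x y w, F x y w = U (x, y) w - U (y, x) w.
Hypothesis F_centered : forall x y, 'E_P[F x y]%E = 0%:E.
Local Notation se := (se_kernel sigma_u Sigma_u).
Local Notation q x y := (inv_quad Sigma_u (colvec x - colvec y)).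

Lemma skew_measurable x y : measurable_fun setT (F x y).
Proof.
have -> : F x y = U (x, y) \- U (y, x) by apply/funext => w; rewrite F_def.
by apply: measurable_funB; exact: measurable_funPT.
Qed.

(** The mean of [U] is arbitrary, but centring of [F] forces it to agree at (x, y) and (y, x). So
    [F] is also the difference of the centred values of [U], and the four covariances combine
    bilinearly. *)
Lemma skew_has_mean_mul x y x' y' : has_mean P (fun w => F x y w * F x' y' w)
  (se (x, y) (x', y') - se (x, y) (y', x')
   - (se (y, x) (x', y') - se (y, x) (y', x'))).
Proof.
have UM p : exists mv : R * R, gaussian_moments P (U p) mv.1 mv.2.
  have := @U_gaussian 1 (fun=> p) (fun=> 1).
  have -> : (fun w => \sum_(j < 1) 1 * U p w) = U p.
    by apply/funext => w; rewrite big_ord1 mul1r.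
  by move=> /(gaussian_rv_moments (measurable_funPT (U p)))[m [v h]]; exists (m, v).
have [mv Hmv] := choice UM.
have mE a b : (mv (a, b)).1 = (mv (b, a)).1.
  have [_ h1 _ _] := Hmv (a, b); have [_ h2 _ _] := Hmv (b, a).
  have h : has_mean P (F a b) ((mv (a, b)).1 - (mv (b, a)).1).
    by apply: eq_has_mean (has_meanB h1 h2) => w /=; rewrite F_def.
  have := F_centered a b; rewrite unlock h.2 => -[/eqP].
  by rewrite subr_eq0 => /eqP.
have hc p p' := gaussian_moments_cov (Hmv p) (Hmv p') (U_covariance p p').
apply: eq_has_mean (has_meanB
  (has_meanB (hc (x, y) (x', y')) (hc (x, y) (y', x')))
  (has_meanB (hc (y, x) (x', y')) (hc (y, x) (y', x')))) => w /=.
rewrite !F_def (mE y x) (mE y' x').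
by ring.
Qed.

Lemma skew_has_mean_sqr x y : has_mean P (fun w => F x y w ^+ 2)
  (2 * sigma_u ^+ 2 * (1 - expR (- q x y))).
Proof.
have := skew_has_mean_mul x y x y.
rewrite /se_kernel/= !subrr inv_quad0 mulr0 oppr0 addr0 expR0.
rewrite -(opprB (colvec x) (colvec y)) inv_quadN.
have -> : - (2^-1 * q x y) - 2^-1 * q x y = - q x y by field.
have -> : sigma_u ^+ 2 * 1 - sigma_u ^+ 2 * expR (- q x y) -
    (sigma_u ^+ 2 * expR (- q x y) - sigma_u ^+ 2 * 1) =
  2 * sigma_u ^+ 2 * (1 - expR (- q x y)) by ring.
by apply: eq_has_mean => w; rewrite expr2.
Qed.

Lemma skew_has_mean_cross x y z : has_mean P (fun w => F x y w * F x z w)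
  (2 * sigma_u ^+ 2 *
    (expR (- (2^-1 * q y z)) - expR (- (2^-1 * (q x z + q x y))))).
Proof.
have := skew_has_mean_mul x y x z.
rewrite /se_kernel/= !subrr inv_quad0 mulr0 oppr0 !add0r !addr0.
rewrite -(opprB (colvec x) (colvec y)) inv_quadN.
set a := expR (- (2^-1 * q y z)).
have -> : - (2^-1 * q x z) - 2^-1 * q x y = - (2^-1 * (q x z + q x y)) by ring.
have -> : - (2^-1 * q x y) - 2^-1 * q x z = - (2^-1 * (q x z + q x y)) by ring.
set b := expR (- _).
by have -> : sigma_u ^+ 2 * a - sigma_u ^+ 2 * b - (sigma_u ^+ 2 * b - sigma_u ^+ 2 * a) =
  2 * sigma_u ^+ 2 * (a - b) by ring.
Qed.

End skew_gaussian_process.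

Section kernel_means.
Variables (R : realType) (T : nat) (Sigma_u Sigma_x : 'M[R]_T).
Hypotheses (Sigma_u_spd : spd_mx Sigma_u) (Sigma_x_spd : spd_mx Sigma_x).
Variable piX : probability (T.-tuple R) R.
Hypothesis piX_gaussian : multivariate_gaussian piX Sigma_x.
Variable M : 'M[R]_T.
Hypothesis M_similar : similar_in unitmx (invmx Sigma_u *m Sigma_x) M.
Local Notation E := (T.-tuple R).
Local Notation q x y := (inv_quad Sigma_u (colvec x - colvec y)).
Local Notation D k := (\det (1%:M + k *: M) `^ (- 2^-1)).

Let has_mean_triple (a0 a1 a2 b0 b1 b2 : R) :
  a0 + a1 + a2 = 0 -> b0 + b1 + b2 = 0 -> a0 * b0 + a1 * b1 + a2 * b2 = 0 ->
  has_mean (iid3 piX) (fun z => expR (- 2^-1 *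
    (inv_quad Sigma_u (a0 *: colvec z.1 + a1 *: colvec z.2.1 + a2 *: colvec z.2.2) +
     inv_quad Sigma_u (b0 *: colvec z.1 + b1 *: colvec z.2.1 + b2 *: colvec z.2.2))))
  (D (a0 ^+ 2 + a1 ^+ 2 + a2 ^+ 2) * D (b0 ^+ 2 + b1 ^+ 2 + b2 ^+ 2)).
Proof.
move=> ha hb hab.
pose mk (x y z : R) : 'rV[R]_3 := \row_k nth 0 [:: x; y; z] k.
have mkE x y z x' y' z' : (mk x y z *m (mk x' y' z')^T) 0 0 = x * x' + y * y' + z * z'.
  by rewrite mxE !big_ord_recl big_ord0 !mxE/= addr0 addrA.
have := @has_mean_inv_quad_triple _ _ _ _ Sigma_u_spd Sigma_x_spd _ piX_gaussian M
  (mk a0 a1 a2) (mk b0 b1 b2) M_similar.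
rewrite !mkE /triple_comb !mxE/= -!expr2.
by apply.
Qed.

Let D0 : D 0 = 1.
Proof. by rewrite scale0r addr0 det1 powR1. Qed.

Let sqrt2 : Num.sqrt 2 ^+ 2 = 2 :> R.
Proof. by rewrite sqr_sqrtr. Qed.

(** The exponent lacks the factor 1/2, so the difference is scaled by the square root of 2 and |a|^2
    = 2 + 2. The second form is zero and contributes [D 0], which is 1. *)
Lemma has_mean_expR_quad12 : has_mean (iid3 piX) (fun z => expR (- q z.1 z.2.1)) (D 4).
Proof.
have := @has_mean_triple (Num.sqrt 2) (- Num.sqrt 2) 0 0 0 0.
rewrite sqrrN sqrt2 expr0n/= !addr0 D0 mulr1 subrr !mulr0 !addr0 => /(_ erefl erefl erefl).
have -> : 2 + 2 = 4 :> R by ring.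
apply: eq_has_mean => z; rewrite !scale0r !addr0 inv_quad0 addr0 scaleNr -scalerBr.
by rewrite inv_quadZ sqrt2 mulNr mulKf.
Qed.

Lemma has_mean_expR_quad13 : has_mean (iid3 piX) (fun z => expR (- q z.1 z.2.2)) (D 4).
Proof.
have := @has_mean_triple (Num.sqrt 2) 0 (- Num.sqrt 2) 0 0 0.
rewrite sqrrN sqrt2 expr0n/= !addr0 D0 mulr1 subrr !mulr0 !addr0 => /(_ erefl erefl erefl).
have -> : 2 + 2 = 4 :> R by ring.
apply: eq_has_mean => z; rewrite !scale0r !addr0 inv_quad0 addr0 scaleNr -scalerBr.
by rewrite inv_quadZ sqrt2 mulNr mulKf.
Qed.

Lemma has_mean_expR_quad23 :
  has_mean (iid3 piX) (fun z => expR (- (2^-1 * q z.2.1 z.2.2))) (D 2).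
Proof.
have := @has_mean_triple 0 1 (- 1) 0 0 0.
rewrite sqrrN expr1n expr0n/= add0r !addr0 D0 mulr1 subrr !mulr0 !addr0 => /(_ erefl erefl erefl).
have -> : 1 + 1 = 2 :> R by ring.
apply: eq_has_mean => z; rewrite !scale0r !addr0 add0r inv_quad0 addr0 scaleNr !scale1r.
by rewrite mulNr.
Qed.

(* With u = x - w and v = x - y, the parallelogram law replaces [q u + q v] by
   [(q (y - w) + q (2 x - y - w)) / 2], whose two linear forms are uncorrelated. *)
Lemma has_mean_expR_quad_cross :
  has_mean (iid3 piX) (fun z => expR (- (2^-1 * (q z.1 z.2.2 + q z.1 z.2.1)))) (D 1 * D 3).
Proof.
(* [h] absorbs the 1/2 of the parallelogram law: (0, h, -h) has squared norm 1 and (2h, -h, -h) has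
   squared norm 6/2 = 3. *)
pose h := (Num.sqrt 2 : R)^-1.
have h2 : h ^+ 2 = 2^-1 by rewrite /h exprVn sqrt2.
have := @has_mean_triple 0 h (- h) (2 * h) (- h) (- h).
have -> : 0 ^+ 2 + h ^+ 2 + (- h) ^+ 2 = 1 by rewrite sqrrN h2; field.
have -> : (2 * h) ^+ 2 + (- h) ^+ 2 + (- h) ^+ 2 = 3 by rewrite sqrrN exprMn h2; field.
have e1 : 0 + h - h = 0 by ring.
have e2 : 2 * h - h - h = 0 by ring.
have e3 : 0 * (2 * h) + h * - h + - h * - h = 0 by ring.
move=> /(_ e1 e2 e3); apply: eq_has_mean => z.
set x := colvec z.1; set y := colvec z.2.1; set w := colvec z.2.2.
have -> : 0 *: x + h *: y + - h *: w = h *: ((x - w) - (x - y)).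
  by apply/colP => i; rewrite !mxE; ring.
have -> : (2 * h) *: x + - h *: y + - h *: w = h *: ((x - w) + (x - y)).
  by apply/colP => i; rewrite !mxE; ring.
rewrite !inv_quadZ h2 -mulrDr (inv_quad_parallelogram Sigma_u_spd).
by rewrite mulKf// mulNr.
Qed.

End kernel_means.

Lemma mutually_independent_indep_iid3 (R : realType) d d' (Omega : measurableType d)
    (E : measurableType d') (P : probability Omega R) (F : E -> E -> Omega -> R)
    (pi : probability E R) (X Y W : {RV P >-> E}) :
  has_law X pi -> has_law Y pi -> has_law W pi ->
  mutually_independent P
    (tnth [tuple <<s random_function_events F >>; sigma_rv X; sigma_rv Y; sigma_rv W]) ->
  indep_iid3 P F pi X Y W.
Proof.
move=> hX hY hW ind A B1 B2 B3 GA m1 m2 m3.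
pose S := [tuple A; X @^-1` B1; Y @^-1` B2; W @^-1` B3].
have pre (Z : {RV P >-> E}) B : measurable B -> sigma_rv Z (Z @^-1` B).
  by move=> mB; exists B => //; rewrite setTI.
have := ind [set: 'I_4]%SET (tnth S).
have -> : \bigcap_(i in [set` [set: 'I_4]%SET]) tnth S i =
    A `&` (X @^-1` B1 `&` (Y @^-1` B2 `&` W @^-1` B3)).
  apply/seteqP; split => [w h|w [h0 [h1 [h2 h3]]] i _].
    have {}h i : tnth S i w by apply: h; rewrite /= finset.in_setT.
    by do ![split]; [exact: (h 0)|exact: (h 1)|exact: (h 2)|exact: (h 3)].
  by case: i => [[|[|[|[|//]]]] p]; rewrite (tnth_nth set0).
move=> ->; last first.
  case=> [[|[|[|[|//]]]] p] _; rewrite !(tnth_nth set0)/=.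
  - exact: GA.
  - exact: pre.
  - exact: pre.
  - exact: pre.
rewrite (eq_bigl xpredT) => [|i]; last by rewrite finset.in_setT.
rewrite !big_ord_recl big_ord0 mule1 !(tnth_nth set0)/=.
by rewrite -(hX _ m1) -(hY _ m2) -(hW _ m3).
Qed.

Theorem mainTheorem4 (R : realType) (T : nat) (T_ge1 : (1 <= T)%N)
    (Sigma_u Sigma_x : 'M[R]_T)
    (Sigma_u_spd : spd_mx Sigma_u) (Sigma_x_spd : spd_mx Sigma_x)
    (sigma_u : R) (sigma_u_gt0 : 0 < sigma_u)
    (d : measure_display) (Omega : measurableType d) (P : probability Omega R)
    (U : T.-tuple R * T.-tuple R -> {RV P >-> R})
    (U_gaussian : gaussian_process P (fun p => U p : Omega -> R))
    (U_covariance : forall p q : T.-tuple R * T.-tuple R,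
       covariance P (U p) (U q) = (se_kernel sigma_u Sigma_u p q)%:E)
    (F : T.-tuple R -> T.-tuple R -> Omega -> R)
    (F_def : forall x y w, F x y w = U (x, y) w - U (y, x) w)
    (F_measurable : measurable_random_function F)
    (F_centered : forall x y, 'E_P[F x y]%E = 0%:E)
    (piX : probability (T.-tuple R) R)
    (piX_gaussian : multivariate_gaussian piX Sigma_x)
    (X Y W : {RV P >-> T.-tuple R})
    (X_law : has_law X piX) (Y_law : has_law Y piX) (W_law : has_law W piX)
    (XYWF_independent : mutually_independent P
       (tnth [tuple <<s random_function_events F >>;
                    sigma_rv X; sigma_rv Y; sigma_rv W]))
    (M : 'M[R]_T) (M_similar : similar_in unitmx (invmx Sigma_u *m Sigma_x) M) :
  shared_endpoint_correlation P F X Y W =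
    ((\det (1%:M + 2 *: M)) `^ (- 2^-1)
       - (\det (1%:M + M)) `^ (- 2^-1) * (\det (1%:M + 3 *: M)) `^ (- 2^-1))
    / (1 - (\det (1%:M + 4 *: M)) `^ (- 2^-1))
  /\
  forall lambda r : 'I_T -> R,
    char_poly M = \prod_(j < T) ('X - (lambda j)%:P) ->
    (forall j, r j = Num.sqrt (lambda j)) ->
    shared_endpoint_correlation P F X Y W =
      (\prod_(j < T) (1 + 2 * r j ^+ 2) `^ (- 2^-1)
         - \prod_(j < T) ((1 + r j ^+ 2) `^ (- 2^-1)
                          * (1 + 3 * r j ^+ 2) `^ (- 2^-1)))
      / (1 - \prod_(j < T) (1 + 4 * r j ^+ 2) `^ (- 2^-1)).
Proof.
have GS := random_function_events_measurable (skew_measurable F_def).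
have F_skew x y w : F y x w = - F x y w by rewrite !F_def opprB.
pose c2 := 2 * sigma_u ^+ 2.
have c20 : c2 != 0 by rewrite mulf_neq0// expf_neq0// gt_eqF.
have s_mean := has_meanZ c2 (has_meanB (has_mean_cst (iid3 piX) 1)
  (has_mean_expR_quad12 Sigma_u_spd Sigma_x_spd piX_gaussian M_similar)).
have s_mean' := has_meanZ c2 (has_meanB (has_mean_cst (iid3 piX) 1)
  (has_mean_expR_quad13 Sigma_u_spd Sigma_x_spd piX_gaussian M_similar)).
have c_mean := has_meanZ c2 (has_meanB
  (has_mean_expR_quad23 Sigma_u_spd Sigma_x_spd piX_gaussian M_similar)
  (has_mean_expR_quad_cross Sigma_u_spd Sigma_x_spd piX_gaussian M_similar)).
have rhoE := @shared_endpoint_correlationE _ _ _ _ _ P F GS F_measurable F_skew piX _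
  (skew_has_mean_sqr U_gaussian U_covariance F_def F_centered) _ _ s_mean s_mean'
  X Y W (measurable_funPT X) (measurable_funPT Y) (measurable_funPT W)
  (mutually_independent_indep_iid3 X_law Y_law W_law XYWF_independent) _ _
  (fun x y w => skew_has_mean_cross U_gaussian U_covariance F_def F_centered x y w) c_mean.
have rho_det : shared_endpoint_correlation P F X Y W =
    ((\det (1%:M + 2 *: M)) `^ (- 2^-1)
       - (\det (1%:M + M)) `^ (- 2^-1) * (\det (1%:M + 3 *: M)) `^ (- 2^-1))
    / (1 - (\det (1%:M + 4 *: M)) `^ (- 2^-1)).
  (* The factor [c2] = 2 sigma_u^2, common to the variance and the covariance, cancels here. *)
  by rewrite rhoE scale1r invfM mulrACA mulVf// mul1r mulrC.
split=> // lambda r charE rE; rewrite rho_det.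
have pE k : 0 <= k -> (\det (1%:M + k *: M)) `^ (- 2^-1) =
    \prod_(j < T) (1 + k * r j ^+ 2) `^ (- 2^-1).
  by move=> k0; apply: (powR_det_1D Sigma_u_spd Sigma_x_spd M_similar charE).
have := pE 1 ler01; rewrite scale1r => pE1.
rewrite pE1 !pE// -big_split/=; congr ((_ - _) / _).
by apply: eq_bigr => j _; rewrite mul1r.
Qed.
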